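(* Suppose $\phi'(1)=1$ and let $x>0$. If the random walk $S$ is right continuous with $\phi$, then $$\lim_{n\to+\infty}\frac1n\ln\mathbb{P}(A_n\ge xn)=-x\,\Lambda_r^*(1/x).$$ If the random walk $S$ is left continuous with $\phi$, then $$\lim_{n\to+\infty}\frac1n\ln\mathbb{P}(A_n\ge xn)=-x\,\Lambda_l^*(1/x).$$
   Context: Random walk and weak records. Let $X_1,X_2,\dots$ be i.i.d. integer-valued random variables, $S_0=0$, $S_n=\sum_{i=1}^nX_i$ for $n\ge1$, and $M_n=\max_{0\le m\le n}S_m$ for $n\ge0$. Let $T_0=0$ and $T_n=\inf\{m>T_{n-1}: S_m\ge M_{m-1}\}$ for $n\ge1$ (with $\inf\emptyset=+\infty$), and let $A_n=\sup\{k\ge1: T_k\le n\}$ for $n\ge1$ (with $\sup\emptyset=0$). $A_n$ is the weak record number up to time $n$. Let $q>0$ and $p_n\ge0$ ($n\ge0$) with $q+\sum_{n\ge0}p_n=1$, and let $\phi(s)=q+\sum_{n=0}^\infty p_ns^{n+1}$, $s\in[0,1]$; $\phi'(1)$ denotes the left derivative at $1$. $S$ is right continuous with $\phi$ if $\mathbb{P}(X_i=1)=q$ and $\mathbb{P}(X_i=-n)=p_n$ for all $n\ge0$. $S$ is left continuous with $\phi$ if $\mathbb{P}(X_i=-1)=q$ and $\mathbb{P}(X_i=n)=p_n$ for all $n\ge0$. For $s\in[0,1]$ let $h(s)$ be the minimal non-negative solution $x\in[0,1]$ of $x=s\phi(x)$. For $\lambda\in(-\infty,0]$ let $$\Lambda_r(\lambda)=\ln\left(1+qe^\lambda-\frac{qe^\lambda}{h(e^\lambda)}\right),\qquad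 \Lambda_l(\lambda)=\lambda+\ln\left(\frac{1-\phi(h(e^\lambda))}{1-h(e^\lambda)}\right),$$ where at $\lambda=0$ the value of $\Lambda_l$ is understood as the limit $\lambda\to0-$, i.e. $\Lambda_l(0)=0$. For $x\ge0$ define, with values in $(-\infty,+\infty]$, $$\Lambda_r^*(x)=\sup_{\lambda\le0}\{x\lambda-\Lambda_r(\lambda)\},\qquad \Lambda_l^*(x)=\sup_{\lambda\le0}\{x\lambda-\Lambda_l(\lambda)\}.$$ When $\phi'(1)=1$, for each $x>1$ there are unique $G_r(x),G_l(x)\in(-\infty,0)$ with $\Lambda_r'(G_r(x))=x$ and $\Lambda_l'(G_l(x))=x$, and explicitly: $\Lambda_r^*(x)=xG_r(x)-\Lambda_r(G_r(x))$ for $x>1$, $\Lambda_r^*(1)=-\ln(q+p_0)$, $\Lambda_r^*(x)=+\infty$ for $x<1$; $\Lambda_l^*(x)=xG_l(x)-\Lambda_l(G_l(x))$ for $x>1$, $\Lambda_l^*(1)=-\ln(1-q)$, $\Lambda_l^*(x)=+\infty$ for $x<1$. Conventions: $\ln0=-\infty$, and limits are taken in $[-\infty,+\infty]$. *)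

(* Defs.v *)
From HB Require Import structures.
From mathcomp Require Export all_boot all_order all_algebra.
From mathcomp Require Export all_classical all_reals all_analysis.
Export Order.TTheory GRing.Theory Num.Theory numFieldNormedType.Exports.

Set Implicit Arguments.
Unset Strict Implicit.
Unset Printing Implicit Defensive.

Local Open Scope classical_set_scope.
Local Open Scope ring_scope.

(* The discrete sigma-algebra on [int], as the library has for [nat]. *)
HB.instance Definition _ := isPointed.Build int 0.
HB.instance Definition _ := @isMeasurable.Build default_measure_display
  int discrete_measurable discrete_measurable0
  discrete_measurableC discrete_measurableU.

Section iid.
Context d (Omega : measurableType d) (R : realType) (P : probability Omega R).
Variable X : nat -> {RV P >-> int}.

Definition mutually_independent : Prop :=
  forall (J : seq nat) (B : nat -> set int), uniq J ->
    P [set w | forall i, i \in J -> B i (X i w)] =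
    (\prod_(i <- J) P (X i @^-1` B i))%E.

Definition identically_distributed : Prop :=
  forall (i j : nat) (B : set int), P (X i @^-1` B) = P (X j @^-1` B).

Definition iid : Prop := mutually_independent /\ identically_distributed.

(* The index is shifted: [X i] is the (i+1)-st step of the walk. *)
Definition walk (n : nat) (w : Omega) : int := \sum_(i < n) X i w.

Definition walk_max (n : nat) (w : Omega) : int :=
  \big[Order.max/walk 0 w]_(m < n.+1) walk m w.

(* Valued in [\bar R] because the record times may be infinite;
   [ereal_inf set0 = +oo]. The time m is positive here, so that [m.-1] is
   never truncated: m > T_0 = 0. *)
Fixpoint record_time (n : nat) (w : Omega) : \bar R :=
  match n with
  | 0%N => 0%E
  | n'.+1 => ereal_inf [set m%:R%:E | m in [set m : nat |
      (record_time n' w < m%:R%:E)%E /\ walk_max m.-1 w <= walk m w]]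
  end.

(* The set is bounded by n, and the real supremum satisfies [sup set0 = 0]. *)
Definition record_number (n : nat) (w : Omega) : R :=
  sup [set k%:R | k in [set k : nat |
    (1 <= k)%N /\ (record_time k w <= n%:R%:E)%E]].

Definition right_continuous_walk (q : R) (p : nat -> R) : Prop :=
  forall i, P (X i @^-1` [set 1]) = q%:E /\
    forall n : nat, P (X i @^-1` [set - n%:Z]) = (p n)%:E.

Definition left_continuous_walk (q : R) (p : nat -> R) : Prop :=
  forall i, P (X i @^-1` [set - 1]) = q%:E /\
    forall n : nat, P (X i @^-1` [set n%:Z]) = (p n)%:E.

End iid.

Section rate.
Context (R : realType) (q : R) (p : nat -> R).

(* Meaningful for s in [0, 1], where the series converges. *)
Definition phi (s : R) : R := q + limn (fun N => \sum_(0 <= n < N) p n * s ^+ n.+1).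

Definition left_derivative_at (f : R -> R) (a l : R) : Prop :=
  t^-1 * (f (a + t) - f a) @[t --> 0^'-] --> l.

Definition h_solutions (s : R) : set R :=
  [set x | 0 <= x <= 1 /\ x = s * phi x].

(* The minimal element of [h_solutions s]; the default value 0 is irrelevant
   for s in [0, 1], where a minimal solution exists. *)
Definition h (s : R) : R :=
  xget 0 [set x | h_solutions s x /\ forall y, h_solutions s y -> x <= y].

Definition Lambda_r (l : R) : R :=
  ln (1 + q * expR l - q * expR l / h (expR l)).

Definition Lambda_l (l : R) : R :=
  if l == 0 then 0
  else l + ln ((1 - phi (h (expR l))) / (1 - h (expR l))).

End rate.

Definition legendre (R : realType) (L : R -> R) (x : R) : \bar R :=
  ereal_sup [set (x * l - L l)%:E | l in [set l : R | l <= 0]].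

(* Main.v *)
Require Import Defs.
From mathcomp Require Import ring lra zify.

(** The successive waiting times between weak records are independent copies
    of the first record time T, because the walk seen from its running maximum
    starts afresh at each record. At least k records occur up to time n when k
    copies of T have a sum of at most n, so the statement is a lower-tail
    large deviation principle for sums of independent variables, with
    F(s) = E(s^T) playing the role of the moment generating function.

    Everything about the path is carried by the gap D between the running
    maximum and the current position, a Markov chain on the natural numbers: a
    step z is a record when z >= D, and otherwise the new gap is D - z. For a
    skip-free walk the steps are indexed by the natural numbers with weights
    w_0 = q, w_(n+1) = p_n, the generating function of which is phi. Splitting
    on the first record yields the renewal recursion
      N(k+1, n) = sum_(i < n) f_i N(k, n-i-1),
    where f_i is the probability that the first record occurs at time i+1 and
    N(k, n) the probability of at least k records up to time n
    (record_law_renewal); independence of the steps enters only through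
    record_count_law.

    The function F is found without inverting any transform. For the right
    continuous walk the powers h^D are harmonic for the chain discounted by s
    (since h = s phi(h)), so h^D is the discounted hitting transform from a
    gap D > 0, and one more step from gap 0 gives 1 + qs - qs/h
    (right_passage_gf). For the left continuous walk the geometric weights h^D
    form a left eigenvector: the total h-weight U_n of the survival
    probabilities v_n(D) satisfies U_n = v_n(0) + s U_(n+1), whence
    sum_n s^n v_n(0) = 1/(1 - h) and F = s (1 - phi(h))/(1 - h)
    (potentialS, left_survival_gf).

    For the rate, Chernoff's bound N(k, n) <= s^(-n) F(s)^k is immediate by
    induction on k. The matching lower bound, for x < 1, tilts the weights
    f_i, cut off at a level m, by the s for which the tilted mean of T is 1/x. Such an
    s < 1 exists since E(T) is infinite (mean_infinite), a consequence of
    phi'(1) = 1: the chord slope (1 - phi(t))/(1 - t) tends to 1, and with the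
    identity (1 - h)(1 - s (1 - phi(h))/(1 - h)) = 1 - s this makes
    (1 - F(s))/(1 - s) unbounded (gf_right_steep, gf_left_steep). Under the
    tilt, a Chebyshev estimate is proved by induction directly on the
    recursion, with a downward parabola as a subsolution
    (renewal_chebyshev). Forcing a small fraction of the waiting times to be 1
    creates the room that this estimate needs (renewal_tilt_lower). Finally the
    level m tends to infinity, the tilts staying below a fixed s_0 < 1
    (exists_tilt). *)

Set Implicit Arguments.
Unset Strict Implicit.
Unset Printing Implicit Defensive.

Local Open Scope classical_set_scope.
Local Open Scope ring_scope.

(** * Estimates for a renewal recursion *)

Section renewal.
Context (R : realType) (f : nat -> R) (N : nat -> nat -> R).
Hypothesis f_ge0 : forall i, 0 <= f i.
Hypothesis N0 : forall n, N 0 n = 1.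
Hypothesis NS : forall k n, N k.+1 n = \sum_(i < n) f i * N k (n - i.+1)%N.

Lemma renewal_ge0 k n : 0 <= N k n.
Proof.
elim: k n => [|k IH] n; first by rewrite N0.
by rewrite NS sumr_ge0// => i _; rewrite mulr_ge0.
Qed.

(** Each step of the recursion multiplies s ^+ n * N k n by at most the
    partial generating function. *)
Lemma renewal_chernoff s C k n : 0 < s -> s <= 1 ->
  (forall n, \sum_(i < n) f i * s ^+ i.+1 <= C) -> s ^+ n * N k n <= C ^+ k.
Proof.
move=> s0 s1 FC.
have C0 : 0 <= C by have := FC 0%N; rewrite big_ord0.
elim: k n => [|k IH] n; first by rewrite N0 mulr1 expr0 exprn_ile1// ltW.
rewrite NS mulr_sumr exprS.
apply: (@le_trans _ _ (\sum_(i < n) f i * s ^+ i.+1 * C ^+ k)); last first.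
  by rewrite -mulr_suml ler_wpM2r// exprn_ge0.
apply: ler_sum => i _.
have -> : s ^+ n = s ^+ i.+1 * s ^+ (n - i.+1) by rewrite -exprD subnKC.
rewrite mulrACA [s ^+ i.+1 * _]mulrC.
by rewrite ler_wpM2l// mulr_ge0// exprn_ge0// ltW.
Qed.

(** Restrict to the event that the first j waiting times all equal 1. *)
Lemma renewal_prefix j k n : f 0%N ^+ j * N k n <= N (j + k)%N (j + n)%N.
Proof.
elim: j => [|j IH]; first by rewrite expr0 mul1r.
rewrite !addSn NS big_ord_recl/= subn1/=.
apply: (@le_trans _ _ (f 0%N * N (j + k)%N (j + n)%N)).
  by rewrite exprS -mulrA ler_wpM2l.
by rewrite lerDl sumr_ge0// => i _; rewrite mulr_ge0// renewal_ge0.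
Qed.

(** Chebyshev's inequality for the tilted waiting times, written as a
    subsolution of the recursion. The parabola a ^+ 2 - (n - a) ^+ 2 lies
    below a multiple of s ^+ n at k = 0, and averaging it over one waiting time
    of mean mu and variance V shifts its centre by mu and lowers it by V. *)
Lemma renewal_chebyshev (M K : nat) (s mu V a : R) k n :
  let G := \sum_(i < M) f i * s ^+ i.+1 in
  0 < s -> s <= 1 -> 0 <= mu -> 0 <= V -> 0 <= a -> 2 * a <= K%:R ->
  \sum_(i < M) f i * s ^+ i.+1 * (i.+1%:R - mu) = 0 ->
  \sum_(i < M) f i * s ^+ i.+1 * (i.+1%:R - mu) ^+ 2 = V * G ->
  s ^+ K * G ^+ k * (a ^+ 2 - ((n%:R - k%:R * mu - a) ^+ 2 + k%:R * V))
    <= a ^+ 2 * (s ^+ n * N k n).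
Proof.
move=> G s0 s1 mu0 V0 a0 aK mean var.
have G0 : 0 <= G.
  by apply: sumr_ge0 => i _; rewrite mulr_ge0// exprn_ge0// ltW.
have sX m : 0 <= s ^+ m by rewrite exprn_ge0// ltW.
elim: k n => [|k IH] n.
  rewrite N0 expr0 !mul0r subr0 addr0 !mulr1.
  (* Up to K the parabola is at most a ^+ 2 and s ^+ K <= s ^+ n; beyond K
     >= 2 a it is nonpositive. *)
  have [nK|Kn] := leqP n K.
    rewrite [leRHS]mulrC (@le_trans _ _ (s ^+ K * a ^+ 2))//.
      by rewrite ler_wpM2l// gerBl sqr_ge0.
    by rewrite ler_wpM2r ?sqr_ge0// ler_wiXn2l// ltW.
  apply: (@le_trans _ _ 0); last by rewrite mulr_ge0// sqr_ge0.
  rewrite mulr_ge0_le0// subr_le0.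
  have : (K%:R : R) <= n%:R by rewrite ler_nat ltnW.
  by move=> ?; nra.
rewrite NS.
pose b (i : nat) : R := a ^+ 2 -
  ((n%:R - i.+1%:R - k%:R * mu - a) ^+ 2 + k%:R * V).
have step : \sum_(i < M) f i * s ^+ i.+1 * b i =
   G * (a ^+ 2 - ((n%:R - k.+1%:R * mu - a) ^+ 2 + k.+1%:R * V)).
  have bE i : b i = (a ^+ 2 - ((n%:R - k.+1%:R * mu - a) ^+ 2 + k%:R * V))
      + 2 * (n%:R - k.+1%:R * mu - a) * (i.+1%:R - mu) - (i.+1%:R - mu) ^+ 2.
    by rewrite /b -[k.+1%:R]natr1; ring.
  under eq_bigr do rewrite bE mulrBr mulrDr.
  rewrite big_split/= sumrN big_split/= var -mulr_suml -/G.
  under [X in _ + X - _]eq_bigr do rewrite mulrCA.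
  rewrite -mulr_sumr mean -[k.+1%:R]natr1; ring.
rewrite exprSr -!mulrA -step !mulr_sumr.
rewrite [leRHS](_ : _ = \sum_(i < n) f i * s ^+ i.+1 *
    (a ^+ 2 * (s ^+ (n - i.+1) * N k (n - i.+1)%N))); last first.
  apply: eq_bigr => i _.
  have -> : s ^+ n = s ^+ i.+1 * s ^+ (n - i.+1) by rewrite -exprD subnKC.
  by move: (s ^+ (n - _)) (s ^+ i.+1) => u v; ring.
(* The recursion has no term for i >= n, where the parabola is evaluated at
   negative times and is nonpositive. *)
have bneg i : (n <= i)%N -> b i <= 0.
  move=> ni; rewrite /b subr_le0.
  have ni' : (n%:R : R) <= i.+1%:R by rewrite ler_nat leqW.
  have : 0 <= k%:R * mu by rewrite mulr_ge0.
  have : 0 <= k%:R * V by rewrite mulr_ge0.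
  move: (k%:R * mu) (k%:R * V) => x y y0 x0; nra.
pose t i := f i * s ^+ i.+1 *
    (a ^+ 2 * (s ^+ (n - i.+1) * N k (n - i.+1)%N)).
have t0 i : 0 <= t i by rewrite /t !mulr_ge0// ?sqr_ge0// renewal_ge0.
have tb i : s ^+ K * (G ^+ k * (f i * (s ^+ i.+1 * b i))) <= (if (i < n)%N then t i else 0).
  case: ltnP => ni; last first.
    rewrite mulr_ge0_le0// mulr_ge0_le0// ?exprn_ge0//.
    by rewrite mulr_ge0_le0// mulr_ge0_le0// bneg.
  rewrite (_ : _ * _ = f i * s ^+ i.+1 * (s ^+ K * G ^+ k * b i)); last first.
    by move: (s ^+ K) (s ^+ i.+1) (G ^+ k) => u v t'; ring.
  rewrite /t ler_wpM2l ?mulr_ge0//.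
  by have := IH (n - i.+1)%N; rewrite natrB.
apply: (@le_trans _ _ (\sum_(i < M) (if (i < n)%N then t i else 0))).
  by apply: ler_sum => i _; rewrite -!mulrA; exact: tb.
rewrite -(big_mkord xpredT (fun i => if (i < n)%N then t i else 0)).
rewrite -(big_mkord xpredT t).
rewrite -big_mkcond/=.
rewrite [leRHS](big_nat_widen _ _ (maxn M n)) ?leq_maxr//.
rewrite [leLHS](big_nat_widen _ _ (maxn M n)) ?leq_maxl//.
rewrite big_mkcond [leRHS]big_mkcond/=; apply: ler_sum => i _.
by case: (i < n)%N => //=; case: ifP.
Qed.

End renewal.

(** * Exponential tilting *)

(** The bookkeeping of exponents in renewal_tilt_lower, where lf, ls, lG, l2
    stand for the logarithms of f 0, s, G and 2. *)
Lemma tilt_arith (R : realType) (lf ls lG l2 lN mu x c n j K n' k' : R) :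
  K * ls + k' * lG - l2 <= n' * ls + lN ->
  (2 * (j * mu) + 1 + j - n) * ls <= (K - n') * ls ->
  (x * n + 1) * lG <= k' * lG ->
  j * - (lf + (1 + 2 * mu) * ls) <= (x * lG - ls - c) / 2 * n ->
  2 * (l2 - ls - lG) <= n * (x * lG - ls - c) ->
  c * n <= j * lf + lN.
Proof.
move=> h1 h2 h3 h4 h5.
have -> : c * n = (n * c - (n * (x * lG - ls - c)) / 2) + (n * (x * lG - ls - c)) / 2 by ring.
have {}h2 := lerD h2 h3.
have {}h1 : (K - n') * ls + k' * lG - l2 <= lN by move: h1; rewrite mulrBl; lra.
rewrite -subr_ge0 in h1; rewrite -subr_ge0 in h2; rewrite -subr_ge0 in h4.
rewrite -subr_ge0 in h5; rewrite -subr_ge0; have h6 := h1.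
have := addr_ge0 (addr_ge0 h6 h2) (addr_ge0 h4 (divr_ge0 h5 (ler0n _ 2))).
by set u := (u in _ <= u -> _) => u0; rewrite [leRHS](_ : _ = u)// /u; field.
Qed.

Section renewal_lower.
Context (R : realType) (f : nat -> R) (N : nat -> nat -> R).
Hypothesis f_ge0 : forall i, 0 <= f i.
Hypothesis f0_gt0 : 0 < f 0%N.
Hypothesis f0_le1 : f 0%N <= 1.
Hypothesis N0 : forall n, N 0 n = 1.
Hypothesis NS : forall k n, N k.+1 n = \sum_(i < n) f i * N k (n - i.+1)%N.

(** At the tilt s whose mean is mu = 1/x, the sum of r n waiting times has
    mean close to n, so that Chebyshev's inequality alone says nothing about
    it being at most n. Forcing the first j ~ eps * n waiting times to be 1
    moves the mean below n by a multiple of n, at a cost of order eps in the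
    exponent. *)
Lemma renewal_tilt_lower (M : nat) (s x c : R) (r : nat -> nat) :
  let G := \sum_(i < M.+1) f i * s ^+ i.+1 in
  0 < s -> s < 1 -> 0 < x -> x < 1 -> G <= 1 ->
  \sum_(i < M.+1) f i * s ^+ i.+1 * (x * i.+1%:R - 1) = 0 ->
  c < x * ln G - ln s ->
  (forall n, x * n%:R <= (r n)%:R <= x * n%:R + 1) ->
  \forall n \near \oo, expR (c * n%:R) <= N (r n) n.
Proof.
move=> G s0 s1 x0 x1 G1 mean cpsi rP.
set psi := x * ln G - ln s in cpsi.
have fs0 i : 0 <= f i * s ^+ i.+1 by rewrite mulr_ge0// exprn_ge0// ltW.
have G0 : 0 < G.
  by rewrite /G big_ord_recl ltr_pwDl ?mulr_gt0 ?exprn_gt0// sumr_ge0.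
have lnf : ln (f 0%N) <= 0 by rewrite ln_le0.
have lns : ln s < 0 by rewrite ln_lt0// s0.
have lnG : ln G <= 0 by rewrite ln_le0.
pose mu := x^-1.
have mu1 : 1 < mu by rewrite invf_gt1.
have mu0 : 0 < mu := lt_trans ltr01 mu1.
have xmu : x * mu = 1 by rewrite mulfV// gt_eqF.
pose V := (\sum_(i < M.+1) f i * s ^+ i.+1 * (i.+1%:R - mu) ^+ 2) / G.
have V0 : 0 <= V.
  by rewrite divr_ge0 ?(ltW G0)// sumr_ge0// => i _; rewrite mulr_ge0// sqr_ge0.
have meanmu : \sum_(i < M.+1) f i * s ^+ i.+1 * (i.+1%:R - mu) = 0.
  transitivity (mu * \sum_(i < M.+1) f i * s ^+ i.+1 * (x * i.+1%:R - 1)).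
    rewrite mulr_sumr; apply: eq_bigr => i _; rewrite [RHS]mulrCA.
    congr (_ * _); rewrite mulrBr mulr1 mulrA [mu * x]mulrC xmu mul1r//.
  by rewrite mean mulr0.
have varV : \sum_(i < M.+1) f i * s ^+ i.+1 * (i.+1%:R - mu) ^+ 2 = V * G.
  by rewrite /V divfK// gt_eqF.
(* A bounds the cost per forced waiting time, so with eps * A at most half of
   psi - c the total cost leaves an exponent above c. *)
pose A := - (ln (f 0%N) + (1 + 2 * mu) * ln s).
have A0 : 0 < A by rewrite /A; nra.
pose eps := Num.min x ((psi - c) / (2 * A)).
have psic : 0 < psi - c by rewrite subr_gt0.
have eps0 : 0 < eps by rewrite lt_min x0 divr_gt0// mulr_gt0.
have epsx : eps <= x by rewrite ge_min lexx.
have epsA : eps * A <= (psi - c) / 2.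
  apply: (@le_trans _ _ ((psi - c) / (2 * A) * A)).
    by rewrite ler_wpM2r ?(ltW A0)// ge_min lexx orbT.
  by rewrite invfM mulrA mulfVK// gt_eqF.
pose B := eps * (mu - 1).
have B0 : 0 < B by rewrite mulr_gt0// subr_gt0.
pose D := ln 2 - ln s - ln G.
near=> n.
have n1 : 1 <= n%:R :> R by near: n; exact: nbhs_infty_ger.
have nB : 4 * mu / B <= n%:R by near: n; exact: nbhs_infty_ger.
have nV : 16 * V / B ^+ 2 <= n%:R by near: n; exact: nbhs_infty_ger.
have nD : 2 * D / (psi - c) <= n%:R by near: n; exact: nbhs_infty_ger.
rewrite ler_pdivrMr// in nB.
rewrite ler_pdivrMr ?exprn_gt0// in nV.
rewrite ler_pdivrMr// in nD.
have n0 : 0 < n%:R :> R by apply: lt_le_trans n1.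
have /andP[kl ku] := rP n.
set k := r n in kl ku *.
pose j := Num.truncn (eps * n%:R).
have epsn : 0 <= eps * n%:R by rewrite mulr_ge0 ?ltW.
have /andP[jl ju] := truncn_itv epsn.
rewrite -/j -natr1 in jl ju.
have epsxn : eps * n%:R <= x * n%:R by rewrite ler_wpM2r.
have xn : x * n%:R <= n%:R by rewrite ger_pMl// ltW.
have jk : (j <= k)%N by rewrite -(ler_nat R); lra.
have jn : (j <= n)%N by rewrite -(ler_nat R); lra.
have := renewal_prefix f_ge0 N0 NS j (k - j) (n - j).
rewrite !subnKC// => pre; apply: le_trans pre.
(* a is the room left between the mean of the k - j free waiting times and
   the remaining time n - j; it grows like B * n. *)
pose a := (n - j)%:R - (k - j)%:R * mu.
have aE : a = n%:R - k%:R * mu + j%:R * (mu - 1).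
  by rewrite /a !natrB//; ring.
have kmu : n%:R <= k%:R * mu.
  by have := ler_wpM2r (ltW mu0) kl; rewrite mulrAC xmu mul1r.
have kmu' : k%:R * mu <= n%:R + mu.
  have : k%:R * mu <= (x * n%:R + 1) * mu by rewrite ler_wpM2r// ?(ltW mu0).
  by rewrite mulrDl mul1r mulrAC xmu mul1r.
have aB : B * n%:R / 2 <= a.
  have : (eps * n%:R - 1) * (mu - 1) <= j%:R * (mu - 1).
    by rewrite ler_wpM2r ?subr_ge0 ?(ltW mu1)// lerBlDr ltW.
  by rewrite aE; move: nB; rewrite /B; nra.
have a0 : 0 < a by apply: lt_le_trans aB; rewrite divr_gt0// mulr_gt0.
have aj : a <= j%:R * mu by rewrite aE; have := ler0n R j; nra.
have aV : 2 * ((k - j)%:R * V) <= a ^+ 2.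
  apply: (@le_trans _ _ ((B * n%:R / 2) ^+ 2)); last first.
    have Bn0 : 0 <= B * n%:R / 2 by apply: divr_ge0 => //; apply: mulr_ge0; exact: ltW.
    by apply: lerXn2r aB; rewrite nnegrE// ltW.
  have kjn : (k - j)%:R <= 2 * n%:R :> R.
    by rewrite natrB//; have := ler0n R j; lra.
  have : (k - j)%:R * V <= 2 * n%:R * V by rewrite ler_wpM2r.
  have := ler_wpM2l (ltW n0) nV; nra.
(* An integer at least 2 * a, because the tilt is by integer powers of s. *)
pose K := (Num.truncn (2 * a)).+1.
have a20 : 0 <= 2 * a by rewrite mulr_ge0// ltW.
have /andP[Kl Ku] := truncn_itv a20.
have K1 : K%:R <= 2 * a + 1 by rewrite /K -natr1 lerD2r.
have cheb := @renewal_chebyshev _ f N f_ge0 N0 NS M.+1 K s mu V a (k - j) (n - j)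
  s0 (ltW s1) (ltW (lt_trans ltr01 mu1)) V0 (ltW a0) (ltW Ku) meanmu varV.
rewrite -/G -/a subrr expr0n/= add0r in cheb.
have low : s ^+ K * G ^+ (k - j) / 2 <= s ^+ (n - j) * N (k - j)%N (n - j)%N.
  rewrite -(@ler_pM2l _ (a ^+ 2)) ?exprn_gt0//; apply: le_trans cheb.
  rewrite mulrCA ler_wpM2l ?mulr_ge0 ?exprn_ge0 ?(ltW s0) ?(ltW G0)//.
  lra.
have Npos : 0 < N (k - j)%N (n - j)%N.
  rewrite -(pmulr_rgt0 _ (exprn_gt0 (n - j) s0)); apply: lt_le_trans low.
  by rewrite !mulr_gt0 ?exprn_gt0// invr_gt0.
rewrite -ler_ln ?posrE ?expR_gt0 ?mulr_gt0 ?exprn_gt0// expRK.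
rewrite lnM ?posrE ?exprn_gt0// lnXn//.
have : ln (s ^+ K * G ^+ (k - j) / 2) <= ln (s ^+ (n - j) * N (k - j)%N (n - j)%N).
  by rewrite ler_ln// posrE !mulr_gt0 ?exprn_gt0// invr_gt0.
rewrite !lnM ?posrE ?mulr_gt0 ?exprn_gt0 ?invr_gt0// lnV ?posrE// !lnXn//.
move: (ln (N _ _)) => lN.
rewrite -!(mulr_natl (ln s)) -(mulr_natl (ln G)) -(mulr_natl (ln (f 0%N))) => lnN.
have Kls : (2 * (j%:R * mu) + 1 + j%:R - n%:R) * ln s <= (K%:R - (n - j)%:R) * ln s.
  rewrite ler_wnM2r ?(ltW lns)// natrB// opprB addrA !lerD2r.
  by apply: le_trans K1 _; rewrite lerD2r ler_pM2l.
have kG : (x * n%:R + 1) * ln G <= (k - j)%:R * ln G.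
  rewrite ler_wnM2r//; apply: le_trans ku; rewrite ler_nat leq_subr//.
have jA : j%:R * A <= eps * n%:R * A by rewrite ler_wpM2r// ltW.
have enA : eps * n%:R * A <= (psi - c) / 2 * n%:R.
  by rewrite mulrAC ler_wpM2r.
exact: tilt_arith lnN Kls kG (le_trans jA enA) nD.
Unshelve. all: end_near.
Qed.

End renewal_lower.

(** * Existence of a critical tilt *)

Section generating_function.
Context (R : realType) (f : nat -> R) (F : R -> R).
Hypothesis f_ge0 : forall i, 0 <= f i.
Hypothesis f_le1 : forall n, \sum_(i < n) f i <= 1.
Hypothesis F_cvg : forall s, 0 < s -> s < 1 ->
  \sum_(i < n) f i * s ^+ i.+1 @[n --> \oo] --> F s.

Let term_ge0 s i : 0 < s -> 0 <= f i * s ^+ i.+1.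
Proof. by move=> s0; rewrite mulr_ge0// exprn_ge0// ltW. Qed.

Lemma gf_partial_le s n : 0 < s -> s < 1 -> \sum_(i < n) f i * s ^+ i.+1 <= F s.
Proof.
move=> s0 s1; rewrite -(cvg_lim _ (F_cvg s0 s1))//.
apply: (nondecreasing_cvgn_le (u_ := fun n => \sum_(i < n) f i * s ^+ i.+1)).
  apply/nondecreasing_seqP => m; rewrite big_ord_recr/= lerDl.
  exact: term_ge0.
by apply/cvg_ex; exists (F s); exact: F_cvg.
Qed.

Lemma gf_tail_le s m : 0 < s -> s < 1 ->
  F s <= \sum_(i < m) f i * s ^+ i.+1 + s ^+ m.+1.
Proof.
move=> s0 s1; rewrite -(cvg_lim _ (F_cvg s0 s1))//.
apply: limr_le; first by apply/cvg_ex; exists (F s); exact: F_cvg.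
near=> n.
have mn : (m <= n)%N by near: n; exact: nbhs_infty_ge.
rewrite -(big_mkord xpredT (fun i => f i * s ^+ i.+1)).
rewrite -(big_mkord xpredT (fun i => f i * s ^+ i.+1)).
rewrite (big_cat_nat _ mn)//= lerD2l.
apply: (@le_trans _ _ (\sum_(m <= i < n) f i * s ^+ m.+1)).
  rewrite big_nat_cond [leRHS]big_nat_cond; apply: ler_sum => i /andP[/andP[mi _] _].
  by rewrite ler_wpM2l// ler_wiXn2l// ?ltW.
rewrite -mulr_suml ger_pMl ?exprn_gt0//.
apply: le_trans (f_le1 n).
rewrite -(big_mkord xpredT f) [leRHS](big_cat_nat _ mn)//= lerDr.
by rewrite sumr_ge0.
Unshelve. all: end_near. Qed.

Lemma gf_le s : 0 < s -> s < 1 -> F s <= s.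
Proof. by move=> s0 s1; have := gf_tail_le 0 s0 s1; rewrite big_ord0 add0r expr1. Qed.

Lemma gf_gt0 s : 0 < f 0%N -> 0 < s -> s < 1 -> 0 < F s.
Proof.
move=> f0 s0 s1; apply: lt_le_trans (gf_partial_le 1 s0 s1).
by rewrite big_ord1 mulr_gt0// exprn_gt0.
Qed.

Hypothesis F_to1 : forall e, 0 < e -> exists2 s, 0 < s < 1 & 1 - e <= F s.
Hypothesis F_steep : forall C, exists2 s, 0 < s < 1 & C * (1 - s) < 1 - F s.

(** A finite mean C would give F t - F s <= C (1 - s) for all s < t, and
    letting t tend to 1 would contradict F_steep. *)
Lemma mean_infinite C : exists m, C < \sum_(i < m) i.+1%:R * f i.
Proof.
apply/not_existsP => H.
have bnd m : \sum_(i < m) i.+1%:R * f i <= C by rewrite leNgt; apply/negP/H.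
have [s /andP[s0 s1]] := F_steep C; apply/negP; rewrite -leNgt.
rewrite -subr_ge0.
apply/ler_addgt0Pl => e e0.
have [t /andP[t0 t1] Ft] := F_to1 e0.
suff : F t <= F s + C * (1 - s) by lra.
rewrite -(cvg_lim _ (F_cvg t0 t1))//.
apply: limr_le; first by apply/cvg_ex; exists (F t); exact: F_cvg.
near=> n.
apply: le_trans (lerD (gf_partial_le n s0 s1) (lexx _)).
apply: (@le_trans _ _ (\sum_(i < n) (f i * s ^+ i.+1 + (i.+1%:R * f i) * (1 - s)))).
  apply: ler_sum => i _.
  have : 1 - s ^+ i.+1 <= i.+1%:R * (1 - s).
    rewrite -[leLHS]opprB subrX1 -mulNr opprB mulrC.
    rewrite ler_wpM2r ?subr_ge0 ?(ltW s1)//.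
    rewrite -[X in _ <= X%:R]card_ord -sum1_card natr_sum.
    by apply: ler_sum => j _; rewrite exprn_ile1// ltW.
  move=> /(ler_wpM2l (f_ge0 i)).
  have : f i * t ^+ i.+1 <= f i by rewrite ler_piMr// exprn_ile1// ltW.
  by move: (s ^+ _) (t ^+ _) => u v; lra.
rewrite big_split/= -mulr_suml lerD2l.
by rewrite ler_wpM2r ?subr_ge0 ?(ltW s1) ?bnd.
Unshelve. all: end_near. Qed.

(** The polynomial Q m (s) = sum_(i < m) f i (x (i+1) - 1) s^i is negative
    at 0 and, once the truncated mean exceeds 1/x, positive at 1; its root is
    the tilt of mean 1/x. A root s0 for one level m0 bounds a root for every
    larger level, since the additional coefficients are nonnegative; hence the
    truncation error of F at these roots decays like s0 ^+ m. *)
Lemma exists_tilt x c c' : 0 < f 0%N -> 0 < x -> x < 1 -> c < c' ->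
  (forall s, 0 < s -> s < 1 -> c' <= x * ln (F s) - ln s) ->
  exists m s, [/\ 0 < s < 1,
    \sum_(i < m.+1) f i * s ^+ i.+1 * (x * i.+1%:R - 1) = 0 &
    c < x * ln (\sum_(i < m.+1) f i * s ^+ i.+1) - ln s].
Proof.
move=> f0 x0 x1 cc' Hc'.
pose Q m := \poly_(i < m) (f i * (x * i.+1%:R - 1)).
have QE m s : (Q m).[s] = \sum_(i < m) f i * (x * i.+1%:R - 1) * s ^+ i.
  by rewrite horner_poly.
have [m1 Hm1] := mean_infinite x^-1.
(* Beyond 1/x the coefficients of Q are nonnegative, so raising the level
   can only increase Q. *)
pose m0 := maxn m1 (Num.truncn x^-1).+1.
have tail i : (m0 <= i)%N -> 0 <= x * i.+1%:R - 1.
  move=> mi; rewrite subr_ge0 mulrC -ler_pdivrMr// mul1r.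
  apply: (@le_trans _ _ (Num.truncn x^-1).+1%:R).
    exact: ltW (truncnS_gt _).
  by rewrite ler_nat (leq_trans _ (leqW mi))// leq_maxr.
have Q1 : 0 < (Q m0).[1].
  rewrite QE; under eq_bigr do rewrite expr1n mulr1 mulrBr mulr1 mulrCA [f _ * _]mulrC.
  rewrite sumrB -mulr_sumr subr_gt0 (le_lt_trans (f_le1 _))//.
  rewrite mulrC -ltr_pdivrMr// mul1r (lt_le_trans Hm1)//.
  rewrite -(big_mkord xpredT (fun i => i.+1%:R * f i)).
  rewrite -(big_mkord xpredT (fun i => i.+1%:R * f i)).
  rewrite [leRHS](big_cat_nat _ (leq_maxl m1 (Num.truncn x^-1).+1))//= lerDl.
  by rewrite sumr_ge0// => i _; rewrite mulr_ge0.
have Q0 m : (Q m.+1).[0] < 0.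
  rewrite QE big_ord_recl/= expr0 big1; last by move=> i _; rewrite expr0n mulr0.
  by rewrite mulr1 addr0 mulr1 pmulr_rlt0// subr_lt0.
have m00 : (0 < m0)%N by rewrite leq_max orbT.
have [s0 /andP[s00 s01] Qs0] : exists2 s, 0 < s < 1 & 0 <= (Q m0).[s].
  have [|s /andP[]] := @poly_ivt R (Q m0) 0 1 ler01.
    by rewrite (ltW Q1) -(prednK m00) ltW.
  rewrite le_eqVlt => /predU1P[<-|s0].
    by rewrite rootE -(prednK m00) lt_eqF.
  rewrite le_eqVlt => /predU1P[->|s1]; first by rewrite rootE gt_eqF.
  by rewrite rootE => /eqP Qs; exists s; rewrite ?s0// Qs.
have Qs m : (m0 <= m)%N -> 0 <= (Q m).[s0].
  move=> mm; move: Qs0; rewrite !QE.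
  rewrite -(big_mkord xpredT (fun i => f i * (x * i.+1%:R - 1) * s0 ^+ i)).
  rewrite -(big_mkord xpredT (fun i => f i * (x * i.+1%:R - 1) * s0 ^+ i)).
  move=> /le_trans; apply; rewrite [leRHS](big_cat_nat _ mm)//= lerDl.
  rewrite big_nat_cond sumr_ge0// => i /andP[/andP[mi _] _].
  by rewrite !mulr_ge0 ?tail// exprn_ge0// ltW.
(* The relative error of the truncation is at most s0 ^+ m / f 0, because the
   truncated sum is at least f 0 * s. *)
have : x / f 0%N * s0 ^+ m @[m --> \oo] --> x / f 0%N * 0.
  by apply: cvgMr; apply: cvg_expr; rewrite ger0_norm// ltW.
rewrite mulr0 => /cvgr_lt /(_ (c' - c)); rewrite subr_gt0 => /(_ cc') [m2 _ Hm2].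
pose m := maxn m0 m2.
have [|s /andP[]] := @poly_ivt R (Q m.+1) 0 s0 (ltW s00).
  by rewrite ltW//= Qs// leqW// leq_maxl.
rewrite le_eqVlt => /predU1P[<-|s_gt0 ss0].
  by rewrite rootE lt_eqF.
have s_lt1 := le_lt_trans ss0 s01.
rewrite rootE QE => /eqP sQ.
exists m, s; split; first by rewrite s_gt0.
  transitivity (s * \sum_(i < m.+1) f i * (x * i.+1%:R - 1) * s ^+ i).
    by rewrite mulr_sumr; apply: eq_bigr => i _; rewrite exprS; ring.
  by rewrite sQ mulr0.
set G := \sum_(i < m.+1) f i * s ^+ i.+1.
have G0 : f 0%N * s <= G.
  rewrite /G big_ord_recl/= expr1 lerDl sumr_ge0// => i _; exact: term_ge0.
have Gpos : 0 < G by apply: lt_le_trans G0; rewrite mulr_gt0.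
have FG : F s <= G * (1 + s0 ^+ m / f 0%N).
  apply: (le_trans (gf_tail_le m.+1 s_gt0 s_lt1)).
  rewrite mulrDr mulr1 lerD2l.
  rewrite mulrCA -ler_pdivrMl ?exprn_gt0//.
  rewrite ler_pdivlMr//.
  apply: le_trans G0.
  rewrite mulrC ler_wpM2l ?(ltW f0)//.
  rewrite ler_pdivrMl ?exprn_gt0// exprSr ler_wpM2r ?(ltW s_gt0)//.
  apply: (@le_trans _ _ (s ^+ m)); first by rewrite ler_wiXn2l// ltW.
  by apply: lerXn2r => //; rewrite nnegrE ltW.
have u0 : 0 <= s0 ^+ m / f 0%N by rewrite divr_ge0// exprn_ge0// ltW.
have lnF : ln (F s) <= ln G + s0 ^+ m / f 0%N.
  apply: (@le_trans _ _ (ln (G * (1 + s0 ^+ m / f 0%N)))).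
    by rewrite ler_ln// posrE ?gf_gt0// mulr_gt0// ltr_wpDr.
  rewrite lnM ?posrE// ?ltr_wpDr// lerD2l.
  by apply: le_ln1Dx; rewrite (lt_le_trans _ u0)// ltrN10.
have := Hm2 m (leq_maxr _ _); rewrite mulrAC -mulrA => Hm.
have := Hc' s s_gt0 s_lt1.
have := ler_wpM2l (ltW x0) lnF; rewrite mulrDr.
lra.
Qed.

End generating_function.

(** * The exponential rate of a renewal recursion *)

(** Treats a finite limit and -oo at once; in the latter case the second
    premise is void. *)
Lemma cvge_from_below (R : realType) (u : nat -> \bar R) (l : \bar R) :
  (\forall n \near \oo, (u n <= l)%E) ->
  (forall c : R, (c%:E < l)%E -> \forall n \near \oo, (c%:E <= u n)%E) ->
  u n @[n --> \oo] --> l.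
Proof.
case: l => [r| |] ul lu.
- apply/fine_cvgP; split.
    have lr : ((r - 1)%:E < r%:E)%E by rewrite lte_fin ltrBlDr ltrDl.
    near=> n; rewrite fin_numElt.
    have -> /= : (u n < +oo)%E by apply: le_lt_trans (ltry r); near: n.
    rewrite andbT; apply: (@lt_le_trans _ _ (r - 1)%:E); first exact: ltNyr.
    near: n; exact: lu.
  apply/cvgrPdist_le => e e0.
  have lr : ((r - e)%:E < r%:E)%E by rewrite lte_fin ltrBlDr ltrDl.
  near=> n => /=.
  have : (u n <= r%:E)%E by near: n.
  have : ((r - e)%:E <= u n)%E by near: n; exact: lu.
  case: (u n) => [v| |]//=; rewrite !lee_fin => h1 h2.
  by rewrite ger0_norm ?subr_ge0// lerBlDr addrC -lerBlDr.
- by apply/cvgeyPge => A; apply: lu; rewrite ltry.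
- apply/cvgeNyPle => A; near=> n; apply: (@le_trans _ _ -oo%E); last exact: leNye.
  by near: n.
Unshelve. all: end_near. Qed.

Section renewal_rate.
Context (R : realType) (f : nat -> R) (F L : R -> R) (N : nat -> nat -> R).
Hypothesis f_ge0 : forall i, 0 <= f i.
Hypothesis f0_gt0 : 0 < f 0%N.
Hypothesis f_le1 : forall n, \sum_(i < n) f i <= 1.
Hypothesis F_cvg : forall s, 0 < s -> s < 1 ->
  \sum_(i < n) f i * s ^+ i.+1 @[n --> \oo] --> F s.
Hypothesis F_to1 : forall e, 0 < e -> exists2 s, 0 < s < 1 & 1 - e <= F s.
Hypothesis F_steep : forall C, exists2 s, 0 < s < 1 & C * (1 - s) < 1 - F s.
Hypothesis N0 : forall n, N 0 n = 1.
Hypothesis NS : forall k n, N k.+1 n = \sum_(i < n) f i * N k (n - i.+1)%N.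
Hypothesis L0 : L 0 = 0.
Hypothesis LE : forall l, l < 0 -> L l = ln (F (expR l)).

Lemma renewal_le1 k n : N k n <= 1.
Proof.
have := @renewal_chernoff _ f N f_ge0 N0 NS 1 1 k n ltr01 (lexx _).
rewrite !expr1n mul1r; apply => m.
by under eq_bigr do rewrite expr1n mulr1.
Qed.

(** Chernoff's bound, optimised over the tilt; it holds for every n, not
    only asymptotically. *)
Lemma renewal_rate_le (x : R) (n k : nat) : 0 < x -> (0 < n)%N -> x * n%:R <= k%:R ->
  ((n%:R^-1)%:E * lne (N k n)%:E <= - (x%:E * legendre L (1 / x)%R))%E.
Proof.
move=> x0 n0 xnk.
have n0' : 0 < n%:R :> R by rewrite ltr0n.
have := renewal_ge0 f_ge0 N0 NS k n; rewrite le_eqVlt => /predU1P[<-|Npos].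
  rewrite /lne lexx gt0_muleNy ?leNye// lte_fin invr_gt0//.
rewrite lne_EFin// -EFinM leeNr -EFinN.
suff Leg : (legendre L (1 / x) <= (- (n%:R^-1 * ln (N k n)) / x)%:E)%E.
  apply: (le_trans (lee_wpmul2l _ Leg)); first by rewrite lee_fin ltW.
  by rewrite -EFinM lee_fin mulrC divfK// gt_eqF.
apply: ge_ereal_sup => _ [l /= l0 <-]; rewrite lee_fin ler_pdivlMr//.
rewrite mulrBl mulrAC div1r mulVf ?gt_eqF// mul1r.
move: l0; rewrite le_eqVlt => /predU1P[->|l0].
  rewrite L0 mul0r subrr oppr_ge0 mulr_ge0_le0 ?invr_ge0 ?(ltW n0')//.
  by rewrite ln_le0// renewal_le1.
rewrite LE//.
have s0 := expR_gt0 l.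
have s1 : expR l < 1 by rewrite expR_lt1.
have F0 := gf_gt0 f_ge0 F_cvg f0_gt0 s0 s1.
have lnF : ln (F (expR l)) <= 0.
  by rewrite ln_le0//; apply: le_trans (ltW s1); exact: gf_le.
have := renewal_chernoff f_ge0 N0 NS k n s0 (ltW s1)
  (fun m => gf_partial_le f_ge0 F_cvg m s0 s1).
rewrite -ler_ln ?posrE ?mulr_gt0 ?exprn_gt0//.
rewrite lnM ?posrE ?exprn_gt0// !lnXn// expRK -(mulr_natl l) -(mulr_natl (ln (F _))).
have := ler_wnM2r lnF xnk.
rewrite lerNr opprB. rewrite ler_pdivrMl//.
move: (ln (F _)) (ln (N _ _)) => u v h1 h2.
have -> : n%:R * (u * x - l) = x * n%:R * u - n%:R * l by ring.
by rewrite lerBrDr addrC (le_trans h2).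
Qed.

(** Only the lower bound depends on the position of x with respect to 1: for
    x < 1 it comes from tilting, for x = 1 from the event that every waiting
    time is 1, and for x > 1 the limit is -oo because F s <= s. *)
Theorem renewal_rate (x : R) (r : nat -> nat) : 0 < x ->
  (forall n, x * n%:R <= (r n)%:R < x * n%:R + 1) ->
  ((n%:R^-1)%:E * lne (N (r n) n)%:E)%E @[n --> \oo] -->
    (- (x%:E * legendre L (1 / x)%R))%E.
Proof.
move=> x0 rP; apply: cvge_from_below.
  near=> n; apply: renewal_rate_le => //; first by near: n; exact: nbhs_infty_gt.
  by have /andP[] := rP n.
move=> c cl.
suff low : \forall n \near \oo, expR (c * n%:R) <= N (r n) n.
  near=> n.
  have n0 : (0 < n)%N by near: n; exact: nbhs_infty_gt.
  have n0' : 0 < n%:R :> R by rewrite ltr0n.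
  have lown : expR (c * n%:R) <= N (r n) n by near: n.
  have Npos : 0 < N (r n) n by apply: lt_le_trans lown; exact: expR_gt0.
  rewrite lne_EFin// -EFinM lee_fin ler_pdivlMl// mulrC.
  by rewrite -(expRK (c * _)) ler_ln// posrE expR_gt0.
have bound c1 s : (c1%:E < - (x%:E * legendre L (1 / x)))%E ->
    0 < s -> s < 1 -> c1 < x * ln (F s) - ln s.
  move=> c1l s0 s1; have l0 : ln s < 0 by rewrite ln_lt0// s0.
  rewrite -[in F s](lnK s0) -LE//.
  rewrite -lte_fin; apply: (lt_le_trans c1l).
  rewrite leeNl -EFinN opprB.
  apply: (@le_trans _ _ (x%:E * (1 / x * ln s - L (ln s))%:E)%E).
    rewrite -EFinM lee_fin mulrBr mulrA mulrCA mulfV ?gt_eqF//.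
    by rewrite mulr1 mul1r.
  rewrite lee_wpmul2l ?lee_fin ?(ltW x0)//.
  by apply: ereal_sup_ubound; exists (ln s) => //=; exact: ltW.
have cL s := @bound c s cl.
have f0_le1 : f 0%N <= 1 by have := f_le1 1; rewrite big_ord1.
have [x1|x1|x1] := ltgtP x 1.
- have [c' [cc' Hc']] : exists c', c < c' /\
      forall s, 0 < s -> s < 1 -> c' <= x * ln (F s) - ln s.
    have [c' cc' c'l] : exists2 c', c < c' & (c'%:E < - (x%:E * legendre L (1 / x)))%E.
      move: cl; case: (- _)%E => [l| |]//.
        rewrite lte_fin => cl; exists ((c + l) / 2); rewrite ?lte_fin.
          by rewrite midf_lt.
        by rewrite midf_lt.
      by move=> _; exists (c + 1); rewrite ?ltry// ltrDl.
    by exists c'; split=> // s s0 s1; apply/ltW/bound.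
  have [m [s [/andP[s0 s1] mean cs]]] :=
    exists_tilt f_ge0 f_le1 F_cvg F_to1 F_steep f0_gt0 x0 x1 cc' Hc'.
  apply: (@renewal_tilt_lower _ f N f_ge0 f0_gt0 f0_le1 N0 NS m s x c r) => //.
    apply: le_trans (gf_partial_le f_ge0 F_cvg _ s0 s1) _.
    by apply: le_trans (ltW s1); exact: gf_le.
  by move=> n; have /andP[-> /ltW ->] := rP n.
- exfalso.
  (* For x > 1 the bound x ln (F s) - ln s <= (x - 1) ln s is unbounded below. *)
  pose s := expR (Num.min (c / (x - 1)) (-1)).
  have s0 : 0 < s by exact: expR_gt0.
  have lns : ln s = Num.min (c / (x - 1)) (-1) by rewrite expRK.
  have lns1 : ln s < 0 by rewrite lns gt_min ltrN10 orbT.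
  have s1 : s < 1 by rewrite -expR0 ltr_expR -lns.
  have F0 := gf_gt0 f_ge0 F_cvg f0_gt0 s0 s1.
  have : x * ln (F s) - ln s <= (x - 1) * ln s.
    rewrite mulrBl mul1r lerD2r ler_pM2l// ler_ln ?posrE//.
    exact: (gf_le f_ge0 f_le1 F_cvg s0 s1).
  have : (x - 1) * ln s <= c.
    by rewrite mulrC -ler_pdivlMr ?subr_gt0// lns ge_min lexx.
  by have := cL _ s0 s1; lra.
- have rn n : r n = n.
    have := rP n; rewrite x1 mul1r natr1 => /andP[].
    rewrite ler_nat ltr_nat ltnS => h1 h2; apply/eqP.
    by rewrite eqn_leq h1 h2.
  have ef : expR c <= f 0%N.
    apply/ler_addgt0Pr => e e0.
    pose s := Num.min e 2^-1.
    have s0 : 0 < s by rewrite lt_min e0 invr_gt0/=.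
    have s1 : s < 1 by rewrite gt_min invf_lt1// ltr1n orbT.
    have := cL _ s0 s1; rewrite x1 mul1r => cF.
    have F0 := gf_gt0 f_ge0 F_cvg f0_gt0 s0 s1.
    have : expR c <= F s / s.
      rewrite -(lnK (_ : F s / s \is Num.pos)) ?posrE ?divr_gt0// ler_expR.
      by rewrite ln_div ?posrE// ltW.
    move=> /le_trans; apply.
    rewrite ler_pdivrMr//; apply: le_trans (gf_tail_le f_ge0 f_le1 F_cvg 1 s0 s1) _.
    rewrite big_ord1 expr1 mulrDl lerD2l expr2 ler_wpM2r ?(ltW s0)//.
    by rewrite ge_min lexx.
  near=> n; rewrite rn mulrC expRM_natl.
  have := renewal_prefix f_ge0 N0 NS n 0 0.
  rewrite N0 mulr1 !addn0; apply: le_trans.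
  by apply: lerXn2r; rewrite ?nnegrE ?expR_ge0.
Unshelve. all: end_near. Qed.

End renewal_rate.

(** * The generating function of the steps *)

(** The steps of either walk, numbered so that phi is the generating function
    of their weights: index 0 is the step of probability q, and index n + 1 the
    step of probability p n. *)
Definition step_weight (R : realType) (q : R) (p : nat -> R) (j : nat) : R :=
  if j is n.+1 then p n else q.

Section offspring.
Context (R : realType) (q : R) (p : nat -> R).
Hypothesis hq : 0 < q.
Hypothesis hp : forall n, 0 <= p n.
Hypothesis hqp : (q%:E + \sum_(0 <= n <oo) (p n)%:E = 1)%E.

Local Notation w := (step_weight q p).
Local Notation phi := (phi q p).
Local Notation h := (h q p).

Lemma weight_ge0 j : 0 <= w j.
Proof. by case: j => [|n]/=; [exact: ltW|]. Qed.

Lemma weight_series : (\sum_(0 <= j <oo) (w j)%:E = 1)%E.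
Proof.
rewrite (@nneseries_recl _ xpredT (fun j => (w j)%:E))//=; last first.
  by move=> k _; rewrite lee_fin weight_ge0.
rewrite -(@nneseries_addn _ (fun j => (w j)%:E) 1%N).
  by under eq_eseriesr do rewrite addn1.
by move=> k; rewrite lee_fin weight_ge0.
Qed.

Lemma weight_sum_le1 n : \sum_(0 <= j < n) w j <= 1.
Proof.
rewrite -lee_fin -weight_series -sumEFin.
by apply: nneseries_lim_ge => j _ _; rewrite lee_fin weight_ge0.
Qed.

Lemma weight_cvg1 : \sum_(0 <= j < n) w j @[n --> \oo] --> (1 : R).
Proof.
have : (\sum_(0 <= j < n) (w j)%:E @[n --> \oo] --> 1)%E.
  rewrite -weight_series; apply: is_cvg_nneseries => j _ _.
  by rewrite lee_fin weight_ge0.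
by move=> /fine_cvgP[_]; under eq_fun do rewrite /= sumEFin/=.
Qed.

Lemma phi_cvg s : 0 <= s <= 1 ->
  \sum_(0 <= j < n) w j * s ^+ j @[n --> \oo] --> phi s.
Proof.
move=> /andP[s0 s1].
rewrite -(cvg_shiftS (fun n => \sum_(0 <= j < n) w j * s ^+ j))/=.
under eq_fun do rewrite big_nat_recl//= expr0 mulr1.
apply: cvgD; first exact: cvg_cst.
apply: nondecreasing_is_cvgn.
  apply/nondecreasing_seqP => n; rewrite big_nat_recr//= lerDl.
  by rewrite mulr_ge0// exprn_ge0.
exists 1 => _ [n _ <-].
apply: le_trans (weight_sum_le1 n.+1).
rewrite big_nat_recl//= (@le_trans _ _ (\sum_(0 <= i < n) p i))//.
  by apply: ler_sum => i _; rewrite ler_piMr// exprn_ile1.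
by rewrite lerDr ltW.
Qed.

Lemma phi_series s : 0 <= s <= 1 ->
  (\sum_(0 <= j <oo) (w j * s ^+ j)%:E = (phi s)%:E)%E.
Proof.
move=> s01; have /andP[s0 s1] := s01.
apply: cvg_lim => //.
apply/fine_cvgP; split; first by near=> n; rewrite sumEFin.
by under eq_fun do rewrite /= sumEFin/=; exact: phi_cvg.
Unshelve. all: end_near. Qed.

Lemma phi1 : phi 1 = 1.
Proof.
have := @phi_cvg 1; rewrite ler01 lexx => /(_ isT).
under eq_fun do (under eq_bigr do rewrite expr1n mulr1).
by move=> h1; apply: cvg_unique h1 weight_cvg1.
Qed.

Lemma ler_cvgn (u v : R^nat) (a b : R) : u n @[n --> \oo] --> a ->
  v n @[n --> \oo] --> b -> (forall n, u n <= v n) -> a <= b.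
Proof.
move=> ua vb uv; rewrite -(cvg_lim _ ua)// -(cvg_lim _ vb)//.
apply: ler_lim; [by apply/cvg_ex; exists a|by apply/cvg_ex; exists b|].
by near=> n; exact: uv.
Unshelve. all: end_near. Qed.

Lemma phi_homo s t : 0 <= s -> s <= t -> t <= 1 -> phi s <= phi t.
Proof.
move=> s0 st t1; have s1 := le_trans st t1; have t0 := le_trans s0 st.
apply: (ler_cvgn (phi_cvg (_ : 0 <= s <= 1)) (phi_cvg (_ : 0 <= t <= 1))).
- by rewrite s0.
- by rewrite t0.
move=> n; apply: ler_sum => j _; rewrite ler_wpM2l ?weight_ge0//.
by apply: lerXn2r.
Qed.

Lemma phi_ge_q s : 0 <= s -> s <= 1 -> q <= phi s.
Proof.
move=> s0 s1; apply: le_trans (phi_homo (lexx _) s0 s1).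
apply: (ler_cvgn (cvg_cst q) (u := fun=> q)
  (v := fun n => \sum_(0 <= j < n.+1) w j * 0 ^+ j)).
  rewrite (cvg_shiftS (fun n => \sum_(0 <= j < n) w j * 0 ^+ j)).
  by apply: phi_cvg; rewrite lexx ler01.
move=> n; rewrite big_nat_recl//= expr0 mulr1 lerDl sumr_ge0// => i _.
by rewrite mulr_ge0// exprn_ge0.
Qed.

Lemma phi_le1 s : 0 <= s -> s <= 1 -> phi s <= 1.
Proof. by move=> s0 s1; rewrite -[leRHS]phi1; exact: phi_homo. Qed.

(** The slope of phi between t and 1; it is the power series whose
    coefficients are the tails of the weights, hence convex. *)
Definition chord (t : R) := (1 - phi t) / (1 - t).

(** Convexity of the chord slope between 0 and u, where its value at 0 is
    1 - q: in sum_(i < j) t^i the term i = 0 is constant and the others are at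
    most t/u times their value at u. *)
Lemma chord_convex t u : 0 <= t -> t <= u -> 0 < u -> u < 1 ->
  chord t <= (1 - t / u) * (1 - q) + t / u * chord u.
Proof.
move=> t0 tu u0 u1; set th := t / u; have t1 := le_lt_trans tu u1.
have th0 : 0 <= th by rewrite divr_ge0// ltW.
have th1 : th <= 1 by rewrite ler_pdivrMr// mul1r.
have cv s : 0 <= s < 1 -> (\sum_(0 <= j < n.+1) w j * ((1 - s ^+ j) / (1 - s)))
    @[n --> \oo] --> chord s.
  move=> /andP[s0 s1].
  rewrite (cvg_shiftS (fun n => \sum_(0 <= j < n) w j * ((1 - s ^+ j) / (1 - s)))).
  have -> : (fun n => \sum_(0 <= j < n) w j * ((1 - s ^+ j) / (1 - s))) =
      (fun n => (\sum_(0 <= j < n) w j - \sum_(0 <= j < n) w j * s ^+ j) / (1 - s)).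
    apply/funext => n; rewrite -sumrB mulr_suml.
    by apply: eq_bigr => j _; rewrite mulrA mulrBr mulr1.
  apply: cvgMl; apply: cvgB; first exact: weight_cvg1.
  by apply: phi_cvg; rewrite s0 ltW.
apply: (ler_cvgn (cv t _)
  (v := fun n => (1 - th) * (\sum_(0 <= j < n.+1) w j - q) +
    th * \sum_(0 <= j < n.+1) w j * ((1 - u ^+ j) / (1 - u)))).
- by rewrite t0.
- apply: cvgD; apply: cvgMr; last by apply: cv; rewrite ltW.
  apply: cvgB; last exact: cvg_cst.
  by rewrite (cvg_shiftS (fun n => \sum_(0 <= j < n) w j)); exact: weight_cvg1.
move=> n; rewrite !big_nat_recl//= !expr0 !subrr !mul0r !mulr0 !add0r addrAC subrr add0r.
rewrite !mulr_sumr -big_split/=; apply: ler_sum => j _.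
rewrite (mulrC (1 - th)) [th * _]mulrCA -mulrDr ler_wpM2l//.
have geo (s : R) : s < 1 -> (1 - s ^+ j.+1) / (1 - s) = 1 + \sum_(i < j) s ^+ i.+1.
  move=> s1; have -> : 1 - s ^+ j.+1 = (1 - s) * \sum_(i < j.+1) s ^+ i.
    by rewrite -[LHS]opprB subrX1 -mulNr opprB.
  by rewrite [(1 - s) * _]mulrC mulfK ?subr_eq0 ?gt_eqF// big_ord_recl.
rewrite !geo// mulrDr mulr1 addrA subrK lerD2l mulr_sumr.
apply: ler_sum => i _.
have -> : t = th * u by rewrite divfK// gt_eqF.
rewrite exprMn ler_wpM2r ?exprn_ge0 ?(ltW u0)//.
by rewrite exprS ler_piMr// exprn_ile1.
Qed.

Lemma chord_ge t : 0 <= t -> t < 1 -> 1 - q <= chord t.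
Proof.
move=> t0 t1; rewrite /chord ler_pdivlMr ?subr_gt0//.
suff : phi t <= q + t * (1 - q) by lra.
apply: (ler_cvgn (u := fun n => \sum_(0 <= j < n.+1) w j * t ^+ j)
  (v := fun n => q + t * (\sum_(0 <= j < n.+1) w j - q))).
- rewrite (cvg_shiftS (fun n => \sum_(0 <= j < n) w j * t ^+ j)).
  by apply: phi_cvg; rewrite t0 ltW.
- apply: cvgD; first exact: cvg_cst.
  apply: cvgMr; apply: cvgB; last exact: cvg_cst.
  by rewrite (cvg_shiftS (fun n => \sum_(0 <= j < n) w j)); exact: weight_cvg1.
move=> n; rewrite !big_nat_recl//= expr0 mulr1 lerD2l addrAC subrr add0r mulr_sumr.
apply: ler_sum => j _; rewrite mulrC ler_wpM2r// exprS ler_piMr//.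
by rewrite exprn_ile1// ltW.
Qed.

Lemma chord_homo t u : 0 <= t -> t <= u -> u < 1 -> chord t <= chord u.
Proof.
move=> t0 tu u1; have u0 := le_trans t0 tu.
move: u0; rewrite le_eqVlt => /predU1P[u0|u0].
  by have -> : t = u by apply/eqP; rewrite eq_le tu -u0.
apply: (le_trans (chord_convex t0 tu u0 u1)).
have th1 : t / u <= 1 by rewrite ler_pdivrMr// mul1r.
have := chord_ge (ltW u0) u1; set th := t / u in th1 *.
move=> c; have : 0 <= (1 - th) * (chord u - (1 - q)).
  by rewrite mulr_ge0 ?subr_ge0.
lra.
Qed.

Hypothesis hphi : left_derivative_at phi 1 1.

(** The assumption phi'(1) = 1, as the chord slope is the difference quotient. *)
Lemma chord_to1 e : 0 < e ->
  exists2 t, 0 < t < 1 & forall u, t <= u -> u < 1 -> `|chord u - 1| <= e.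
Proof.
move=> e0; move/cvgrPdist_le : hphi => /(_ e e0).
rewrite /at_left near_withinE => -[d /= d0 Hd].
exists (1 - Num.min (d / 2) 2^-1).
  have m0 : 0 < Num.min (d / 2) 2^-1 by rewrite lt_min divr_gt0//= invr_gt0.
  have m2 : Num.min (d / 2) 2^-1 <= 2^-1 by rewrite ge_min lexx orbT.
  by apply/andP; split; lra.
move=> u ut u1; have := Hd (u - 1).
rewrite /ball_/= sub0r normrN subr_lt0 u1 => /(_ _ isT).
rewrite (addrC 1 (u - 1)) subrK phi1 (distrC 1).
have -> : (u - 1)^-1 * (phi u - 1) = chord u.
  by rewrite /chord -(opprB 1 u) -(opprB 1 (phi u)) invrN mulrNN mulrC.
apply; rewrite ltr0_norm ?subr_lt0// opprB.
have : Num.min (d / 2) 2^-1 <= d / 2 by rewrite ge_min lexx.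
lra.
Qed.

Lemma chord_le1 t : 0 <= t -> t < 1 -> chord t <= 1.
Proof.
move=> t0 t1; apply/ler_addgt0Pl => e e0.
have [u /andP[u0 u1] Hu] := chord_to1 e0.
have m1 : Num.max t u < 1 by rewrite gt_max t1.
have := Hu (Num.max t u); rewrite le_max lexx orbT m1 => /(_ isT isT).
rewrite ler_norml => /andP[_]; rewrite lerBlDr; apply: le_trans.
by apply: chord_homo; rewrite // le_max lexx.
Qed.

(** By convexity the slope, 1 - q at 0 and at most 1 everywhere, cannot reach
    1 before the end of the interval. *)
Lemma chord_lt1 t : 0 <= t -> t < 1 -> chord t < 1.
Proof.
move=> t0 t1; pose u := (t + 1) / 2.
have tu : t < u by rewrite midf_lt.
have u1 : u < 1 by rewrite midf_lt.
have u0 := le_lt_trans t0 tu.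
apply: (le_lt_trans (chord_convex t0 (ltW tu) u0 u1)).
have th0 : 0 <= t / u by rewrite divr_ge0// ltW.
have th1 : t / u < 1 by rewrite ltr_pdivrMr// mul1r.
have := chord_le1 (ltW u0) u1; move: (t / u) th0 th1 => th th0 th1 c1.
have : th * chord u <= th by rewrite ler_piMr.
have : 0 < (1 - th) * q by rewrite mulr_gt0// subr_gt0.
lra.
Qed.

Lemma phi_gt t : 0 <= t -> t < 1 -> t < phi t.
Proof.
move=> t0 t1; have := chord_lt1 t0 t1.
by rewrite /chord ltr_pdivrMr ?subr_gt0//; lra.
Qed.

End offspring.

(** * The minimal solution of x = s phi(x) *)

Section minimal_solution.
Context (R : realType) (q : R) (p : nat -> R).
Hypothesis hq : 0 < q.
Hypothesis hp : forall n, 0 <= p n.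
Hypothesis hqp : (q%:E + \sum_(0 <= n <oo) (p n)%:E = 1)%E.

Local Notation w := (step_weight q p).
Local Notation phi := (phi q p).
Local Notation h := (h q p).
Local Notation chord := (chord q p).

Lemma q_le1 : q <= 1.
Proof.
have := weight_sum_le1 hq hp hqp 1; by rewrite big_nat1.
Qed.

(** Knaster and Tarski: phi is monotone, so the infimum of the
    x with s * phi x <= x is the least fixed point. *)
Lemma h_spec (s : R) : 0 <= s -> s <= 1 ->
  h_solutions q p s (h s) /\ (forall y, h_solutions q p s y -> h s <= y).
Proof.
move=> s0 s1.
suff [x Hx] : [set x | h_solutions q p s x /\
    forall y, h_solutions q p s y -> x <= y] !=set0 by exact: (xgetI 0 Hx).
pose A := [set x : R | 0 <= x <= 1 /\ s * phi x <= x].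
have A1 : A 1.
  by split; rewrite ?ler01 ?lexx// (phi1 hq hp hqp) mulr1.
have lbA : lbound A 0 by move=> x [/andP[]].
have hA : has_inf A by split; [exists 1|exists 0].
have m0 : 0 <= inf A by apply: lb_le_inf => //; exists 1.
have m1 : inf A <= 1 by apply: ge_inf => //; exists 0.
have m_le : s * phi (inf A) <= inf A.
  apply: lb_le_inf; first by exists 1.
  move=> x Ax; have [/andP[x0 x1] sx] := Ax.
  apply: le_trans sx; rewrite ler_wpM2l//.
  by apply: (phi_homo hq hp hqp) => //; apply: ge_inf => //; exists 0.
have mA : A (s * phi (inf A)).
  have pm0 : 0 <= phi (inf A) := le_trans (ltW hq) (phi_ge_q hq hp hqp m0 m1).
  split; last first.
    rewrite ler_wpM2l//; apply: (phi_homo hq hp hqp) => //.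
    by rewrite mulr_ge0.
  rewrite mulr_ge0//=; exact: le_trans m_le m1.
exists (inf A); split.
  split; first by rewrite m0.
  apply/eqP; rewrite eq_le m_le andbT.
  by apply: ge_inf => //; exists 0.
move=> y [y01 yE]; apply: ge_inf; first by exists 0.
by split => //; rewrite -yE.
Qed.

Section subcritical.
Context (s : R).
Hypothesis s0 : 0 < s.
Hypothesis s1 : s < 1.

Lemma h_fix : h s = s * phi (h s).
Proof. by have [[_]] := h_spec (ltW s0) (ltW s1). Qed.

Lemma h_ge0 : 0 <= h s.
Proof. by have [[/andP[]]] := h_spec (ltW s0) (ltW s1). Qed.

Let h_le1 : h s <= 1.
Proof. by have [[/andP[]]] := h_spec (ltW s0) (ltW s1). Qed.

Lemma h_gt0 : 0 < h s.
Proof.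
rewrite h_fix mulr_gt0//; apply: lt_le_trans hq _.
exact: phi_ge_q h_ge0 h_le1.
Qed.

Lemma h_lt1 : h s < 1.
Proof.
rewrite h_fix; apply: le_lt_trans s1; rewrite ger_pMr//.
exact: phi_le1 h_ge0 h_le1.
Qed.

(** A rearrangement of h = s phi(h): it relates the rates at which 1 - h and
    1 - s vanish as s tends to 1. *)
Lemma h_chord : (1 - h s) * (1 - s * chord (h s)) = 1 - s.
Proof.
have h1 : 1 - h s != 0 by rewrite subr_eq0 gt_eqF// h_lt1.
have c : (1 - h s) * chord (h s) = 1 - phi (h s) by rewrite mulrC divfK.
by rewrite mulrBr mulr1 mulrCA c mulrBr -h_fix mulr1; ring.
Qed.

End subcritical.

Hypothesis hphi : left_derivative_at phi 1 1.

(** If q = 1 then phi is constant, and its slope at 1 is 0. *)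
Lemma q_lt1 : q < 1.
Proof.
rewrite lt_neqAle q_le1 andbT; apply/eqP => q1.
have half0 : 0 < 2^-1 :> R by rewrite invr_gt0.
have [t /andP[t0 t1] Ht] := chord_to1 hq hp hqp hphi half0.
have := Ht t (lexx _) t1.
have -> : chord t = 0.
  rewrite /chord (_ : phi t = 1) ?subrr ?mul0r//.
  apply/eqP; rewrite eq_le (phi_le1 hq hp hqp (ltW t0) (ltW t1))/= -[leLHS]q1.
  exact: (phi_ge_q hq hp hqp (ltW t0) (ltW t1)).
by rewrite sub0r normrN normr1 leNgt invf_lt1// ltr1n.
Qed.

Lemma h_at1 : h 1 = 1.
Proof.
have [[/andP[h0 h_le1] hE] _] := h_spec ler01 (lexx 1).
apply/eqP; rewrite eq_le h_le1 leNgt; apply/negP => hlt.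
have := phi_gt hq hp hqp hphi h0 hlt.
by rewrite {1}hE mul1r ltxx.
Qed.

(** As s tends to 1, h_chord forces h to 1: if h s stayed below some u < 1,
    then 1 - s would stay above (1 - u) (1 - chord u) > 0. *)
Lemma h_critical (e : R) : 0 < e -> exists2 s : R, 0 < s < 1 &
  1 - e <= h s /\ 1 - e <= s * chord (h s).
Proof.
move=> e0; pose d : R := Num.min (e / 2) 2^-1.
have d0 : 0 < d by rewrite lt_min divr_gt0//= invr_gt0.
have d1 : d < 1 by rewrite gt_min invf_lt1// ltr1n orbT.
have de : d <= e / 2 by rewrite ge_min lexx.
have [t /andP[t0 t1] Ht] := chord_to1 hq hp hqp hphi d0.
pose u := Num.max t (1 - d).
have u1 : u < 1 by rewrite gt_max t1 gtrBl.
have tu : t <= u by rewrite le_max lexx.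
have du : 1 - d <= u by rewrite le_max lexx orbT.
have u0 : 0 <= u := le_trans (ltW t0) tu.
(* v is the lower bound on 1 - s that h s < u would entail. *)
pose v := (1 - u) * (1 - chord u).
have cu : chord u < 1 by exact: chord_lt1.
have v0 : 0 < v by rewrite mulr_gt0 ?subr_gt0.
pose s := 1 - Num.min d (v / 2).
have m0 : 0 < Num.min d (v / 2) by rewrite lt_min d0 divr_gt0.
have md : Num.min d (v / 2) <= d by rewrite ge_min lexx.
have mv : Num.min d (v / 2) <= v / 2 by rewrite ge_min lexx orbT.
have s1 : s < 1 by rewrite gtrBl.
have s0 : 0 < s by rewrite subr_gt0 (le_lt_trans md).
have hu : u <= h s.
  rewrite leNgt; apply/negP => hu.
  have := h_chord s0 s1.
  have ch := chord_homo hq hp hqp (h_ge0 s0 s1) (ltW hu) u1.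
  have c0 : 0 <= chord (h s).
    apply: le_trans (chord_ge hq hp hqp (h_ge0 s0 s1) (h_lt1 s0 s1)).
    by rewrite subr_ge0 q_le1.
  have sc : s * chord (h s) <= chord u.
    by apply: le_trans ch; rewrite ler_piMl// ltW.
  have : v <= (1 - h s) * (1 - s * chord (h s)).
    by apply: ler_pM; rewrite ?subr_ge0 ?(ltW u1) ?(ltW cu) ?lerB ?(ltW hu).
  rewrite /s in m0 mv *; lra.
exists s; first by rewrite s0.
split; first by apply: le_trans hu; lra.
have := Ht (h s) (le_trans tu hu) (h_lt1 s0 s1).
rewrite ler_norml => /andP[c1 _].
have : (1 - d) * (1 - d) <= s * chord (h s).
  apply: ler_pM; rewrite ?subr_ge0 ?(ltW d1)//; last by lra.
  by rewrite lerB.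
nra.
Qed.

(** The exponential of Lambda_r at ln s. *)
Definition gf_right (s : R) := 1 + q * s - q * s / h s.

(** The exponential of Lambda_l at ln s. *)
Definition gf_left (s : R) := s * chord (h s).

Lemma gf_right_to1 (e : R) : 0 < e -> exists2 s : R, 0 < s < 1 & 1 - e <= gf_right s.
Proof.
move=> e0; pose d : R := Num.min (e / 2) 2^-1.
have d0 : 0 < d by rewrite lt_min divr_gt0//= invr_gt0.
have [s /andP[s0 s1] [hs _]] := h_critical d0.
exists s; first by rewrite s0.
have hs0 := h_gt0 s0 s1; have hs1 := h_lt1 s0 s1.
have d2 : d <= 2^-1 by rewrite ge_min lexx orbT.
have de : d <= e / 2 by rewrite ge_min lexx.
suff : q * s / h s - q * s <= e by rewrite /gf_right; lra.
have -> : q * s / h s - q * s = q * s * (1 - h s) / h s.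
  by field; rewrite gt_eqF.
rewrite ler_pdivrMr//.
apply: (@le_trans _ _ (1 - h s)).
  rewrite ler_piMl ?subr_ge0 ?(ltW hs1)// mulr_ile1 ?(ltW hq) ?(ltW s0) ?(ltW s1)//.
  exact: q_le1.
have : e * (1 - d) <= e * h s by rewrite ler_wpM2l ?(ltW e0).
have : d * e <= 2^-1 * e by rewrite ler_wpM2r ?(ltW e0).
lra.
Qed.

Lemma gf_right_steep (C : R) :
  exists2 s : R, 0 < s < 1 & C * (1 - s) < 1 - gf_right s.
Proof.
pose D : R := `|C| + 1.
have D0 : 0 < D by rewrite ltr_wpDl.
have CD : C < D by rewrite (le_lt_trans (ler_norm C))// ltrDl.
pose d : R := Num.min (q / (4 * D)) 2^-1.
have d0 : 0 < d by rewrite lt_min divr_gt0 ?mulr_gt0//= invr_gt0.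
have d2 : d <= 2^-1 by rewrite ge_min lexx orbT.
have dD : d * D <= q / 4.
  apply: (@le_trans _ _ (q / (4 * D) * D)).
    by rewrite ler_wpM2r ?(ltW D0)// ge_min lexx.
  by rewrite invfM mulrA mulfVK// gt_eqF.
have [s /andP[s0 s1] [hs cs]] := h_critical d0.
exists s; first by rewrite s0.
have hs0 := h_gt0 s0 s1; have hs1 := h_lt1 s0 s1.
have hc := h_chord s0 s1.
have sc : 1 - d <= s.
  apply: le_trans cs _; rewrite ger_pMr//; apply: chord_le1 => //; exact: ltW.
have -> : 1 - gf_right s = q * s * (1 - h s) / h s.
  by rewrite /gf_right; field; rewrite gt_eqF.
rewrite ltr_pdivlMr//.
apply: (@le_lt_trans _ _ (D * (1 - s))).
  apply: (@le_trans _ _ (D * (1 - s) * h s)).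
    by rewrite ler_wpM2r ?(ltW hs0)// ler_wpM2r ?subr_ge0 ?(ltW s1) ?(ltW CD).
  by rewrite ler_piMr ?(ltW hs1)// mulr_ge0 ?subr_ge0 ?(ltW s1) ?(ltW D0).
rewrite -hc mulrCA mulrC ltr_pM2r ?subr_gt0//.
have : D * (1 - s * chord (h s)) <= D * d.
  by rewrite ler_wpM2l ?(ltW D0)//; lra.
have : q * 2^-1 <= q * s by rewrite ler_wpM2l ?(ltW hq)//; lra.
move=> /(lt_le_trans _) qs /le_lt_trans; apply; apply: qs.
by rewrite mulrC (le_lt_trans dD)// ltr_pM2l// ltf_pV2 ?posrE// ltr_nat.
Qed.

Lemma gf_left_to1 (e : R) : 0 < e -> exists2 s : R, 0 < s < 1 & 1 - e <= gf_left s.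
Proof. by move=> e0; have [s ? []] := h_critical e0; exists s. Qed.

Lemma gf_left_steep (C : R) :
  exists2 s : R, 0 < s < 1 & C * (1 - s) < 1 - gf_left s.
Proof.
pose D : R := `|C| + 1.
have D0 : 0 < D by rewrite ltr_wpDl.
have CD : C < D by rewrite (le_lt_trans (ler_norm C))// ltrDl.
have d0 : 0 < D^-1 by rewrite invr_gt0.
have [s /andP[s0 s1] [hs cs]] := h_critical d0.
exists s; first by rewrite s0.
have hs0 := h_gt0 s0 s1; have hs1 := h_lt1 s0 s1.
have hc := h_chord s0 s1.
apply: (@lt_le_trans _ _ (D * (1 - s))); first by rewrite ltr_pM2r// subr_gt0.
rewrite -hc /gf_left mulrA ler_piMl//.
  have : 0 < (1 - h s) * (1 - s * chord (h s)) by rewrite hc subr_gt0.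
  by rewrite pmulr_rgt0 ?subr_gt0// => /ltW; rewrite subr_ge0.
by rewrite mulrC -ler_pdivlMr// mul1r; lra.
Qed.

Lemma Lambda_r0 : Lambda_r q p 0 = 0.
Proof. by rewrite /Lambda_r expR0 h_at1 !mulr1 divr1 addrK ln1. Qed.

Lemma Lambda_lE l : l < 0 -> Lambda_l q p l = ln (gf_left (expR l)).
Proof.
move=> l0; rewrite /Lambda_l lt_eqF//.
have s0 := expR_gt0 l.
have s1 : expR l < 1 by rewrite expR_lt1.
have hs0 := h_gt0 s0 s1; have hs1 := h_lt1 s0 s1.
rewrite /gf_left /chord lnM ?posrE// ?expRK// divr_gt0 ?subr_gt0//.
have := chord_ge hq hp hqp (ltW hs0) hs1.
have c : (1 - h (expR l)) * chord (h (expR l)) = 1 - phi (h (expR l)).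
  by rewrite mulrC divfK// subr_eq0 gt_eqF.
move=> /(lt_le_trans _) cp; rewrite -subr_gt0 -c mulr_gt0 ?subr_gt0//.
by apply: cp; rewrite subr_gt0 q_lt1.
Qed.

End minimal_solution.

(** * The gap below the running maximum as a Markov chain *)

(** A step z taken from a gap D is a weak record when it brings the walk back
    to its maximum at least. *)
Definition reaches (D : nat) (z : int) : bool := D%:Z <= z.

(** Only meaningful when z < D, where the absolute value is D - z. *)
Definition gap_after (D : nat) (z : int) : nat := `|D%:Z - z|%N.

Section records.
Context (R : realType) (w : nat -> R) (x : nat -> int).
Hypothesis w_ge0 : forall j, 0 <= w j.
Hypothesis w_sum : (\sum_(0 <= j <oo) (w j)%:E = 1)%E.

(** Expectation over one step. Values in the extended reals let nonnegative
    sums be exchanged freely. *)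
Definition avg (g : nat -> \bar R) : \bar R :=
  (\sum_(0 <= j <oo) (w j)%:E * g j)%E.

Lemma avg_ge0 g : (forall j, 0 <= g j)%E -> (0 <= avg g)%E.
Proof. by move=> g0; apply: nneseries_ge0 => j _ _; rewrite mule_ge0// lee_fin. Qed.

Lemma eq_avg g1 g2 : (forall j, g1 j = g2 j) -> avg g1 = avg g2.
Proof. by move=> gg; apply: eq_eseriesr => j _; rewrite gg. Qed.

Lemma le_avg g1 g2 : (forall j, 0 <= g1 j)%E -> (forall j, g1 j <= g2 j)%E ->
  (avg g1 <= avg g2)%E.
Proof.
move=> g10 gg; apply: lee_nneseries => j _; first by rewrite mule_ge0// lee_fin.
by rewrite lee_wpmul2l// lee_fin.
Qed.

Lemma avgD g1 g2 : (forall j, 0 <= g1 j)%E -> (forall j, 0 <= g2 j)%E ->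
  avg (fun j => g1 j + g2 j)%E = (avg g1 + avg g2)%E.
Proof.
move=> g10 g20; rewrite -nneseriesD.
- by apply: eq_eseriesr => j _; rewrite ge0_muleDr.
- by move=> j _ _; rewrite mule_ge0// lee_fin.
- by move=> j _ _; rewrite mule_ge0// lee_fin.
Qed.

Lemma avgZ (c : R) g : (forall j, 0 <= g j)%E ->
  avg (fun j => c%:E * g j)%E = (c%:E * avg g)%E.
Proof.
move=> g0; rewrite -nneseriesZl; last by move=> j _; rewrite mule_ge0// lee_fin.
by apply: eq_eseriesr => j _; rewrite muleCA.
Qed.

Lemma avg_sum n (g : nat -> nat -> \bar R) : (forall i j, 0 <= g i j)%E ->
  avg (fun j => \sum_(i < n) g i j)%E = (\sum_(i < n) avg (g i))%E.
Proof.
move=> g0; elim: n => [|n IH].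
  rewrite big_ord0; rewrite /avg eseries0// => j _ _.
  by rewrite big_ord0 mule0.
rewrite big_ord_recr -IH/= -avgD//; last by move=> j; rewrite sume_ge0.
by apply: eq_avg => j; rewrite big_ord_recr.
Qed.

Lemma avg1 : avg (fun=> 1%E) = 1%E.
Proof. by rewrite -[RHS]w_sum; apply: eq_eseriesr => j _; rewrite mule1. Qed.

Lemma avg_cst (c : R) : avg (fun=> c%:E) = c%:E.
Proof.
rewrite -[RHS]mule1 -avg1 -avgZ//.
by apply: eq_avg => j; rewrite mule1.
Qed.

Lemma avg_le1 g : (forall j, 0 <= g j <= 1)%E -> (avg g <= 1)%E.
Proof.
by move=> g01; rewrite -avg1; apply: le_avg => j; have /andP[] := g01 j.
Qed.

Definition is_record (D j : nat) : bool := reaches D (x j).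
Definition next_gap (D j : nat) : nat := gap_after D (x j).

(** The probability of at least k records within n steps, started from gap
    D. *)
Fixpoint record_law (n D k : nat) : \bar R :=
  if n is n'.+1 then
    avg (fun j => if is_record D j then record_law n' 0 k.-1
                  else record_law n' (next_gap D j) k)
  else ((k == 0%N)%:R)%:E.

(** The probability that the first record occurs at step n + 1. *)
Fixpoint passage (n D : nat) : \bar R :=
  if n is n'.+1 then
    avg (fun j => if is_record D j then 0%E else passage n' (next_gap D j))
  else avg (fun j => ((is_record D j)%:R)%:E).

(** The probability of no record within n steps. *)
Fixpoint survival (n D : nat) : \bar R :=
  if n is n'.+1 then
    avg (fun j => if is_record D j then 0%E else survival n' (next_gap D j))
  else 1%E.

Lemma record_law_itv n D k : (0 <= record_law n D k <= 1)%E.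
Proof.
elim: n D k => [|n IH] D k /=; first by case: (k == 0%N); rewrite !lee_fin ?lexx ler01.
apply/andP; split.
  by apply: avg_ge0 => j; case: ifP => _; [have /andP[] := IH 0%N k.-1|
    have /andP[] := IH (next_gap D j) k].
by apply: avg_le1 => j; case: ifP => _; exact: IH.
Qed.

Lemma record_law0 n D : record_law n D 0 = 1%E.
Proof.
elim: n D => [//|n IH] D /=; rewrite -[RHS]avg1.
by apply: eq_avg => j; rewrite !IH if_same.
Qed.

Lemma passage_ge0 n D : (0 <= passage n D)%E.
Proof.
elim: n D => [|n IH] D /=; apply: avg_ge0 => j; first by rewrite lee_fin.
by case: ifP.
Qed.

Lemma survival_itv n D : (0 <= survival n D <= 1)%E.
Proof.
elim: n D => [|n IH] D /=; first by rewrite lexx lee_fin ler01.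
apply/andP; split.
  by apply: avg_ge0 => j; case: ifP => // _; have /andP[] := IH (next_gap D j).
by apply: avg_le1 => j; case: ifP => _; rewrite ?lexx ?lee_fin ?ler01.
Qed.

Lemma survivalS n D : survival n D = (passage n D + survival n.+1 D)%E.
Proof.
elim: n D => [|n IH] D.
  rewrite [LHS]/= -avg1 [passage 0 D]/= [survival 1 D]/= -avgD => [|j|j].
  - by apply: eq_avg => j; case: ifP; rewrite ?adde0 ?add0e.
  - by rewrite lee_fin.
  - by case: ifP; rewrite // lee_fin.
rewrite [LHS]/= [passage _ _]/= [survival n.+2 _]/= -avgD => [|j|j].
- by apply: eq_avg => j; case: ifP; rewrite ?adde0// => _; exact: IH.
- by case: ifP => // _; exact: passage_ge0.
- by case: ifP => // _; have /andP[] := survival_itv n.+1 (next_gap D j).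
Qed.

Lemma passage_sum n D :
  (\sum_(i < n) passage i D + survival n D = 1)%E.
Proof.
elim: n => [|n IH]; first by rewrite big_ord0 add0e.
by rewrite big_ord_recr/= -[RHS]IH [in RHS]survivalS addeA.
Qed.

(** Decomposition at the first record, after which the gap is 0. *)
Lemma record_law_renewal n D k : record_law n D k.+1 =
  (\sum_(i < n) passage i D * record_law (n - i.+1) 0 k)%E.
Proof.
have fin m : record_law m 0 k = (fine (record_law m 0 k))%:E.
  have /andP[l0 l1] := record_law_itv m 0 k.
  by rewrite fineK// ge0_fin_numE// (le_lt_trans l1)// ltry.
have law0 m : (0 <= record_law m 0 k)%E by have /andP[] := record_law_itv m 0 k.
elim: n D => [|n IH] D; first by rewrite big_ord0.
rewrite big_ord_recl/= subn1/= fin muleC -avgZ -?fin; last first.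
  by move=> j; rewrite lee_fin.
under [X in (_ + X)%E]eq_bigr => i _.
  rewrite /bump/= add1n subSS fin muleC -avgZ -?fin; last first.
    by move=> j; case: ifP => // _; exact: passage_ge0.
  over.
rewrite -(@avg_sum n (fun i j => record_law (n - i.+1) 0 k *
  (if is_record D j then 0 else passage i (next_gap D j)))%E) -?avgD.
- apply: eq_avg => j; case: ifP => _.
    by rewrite mule1 big1 ?adde0// => i _; rewrite mule0.
  rewrite mule0 add0e IH; apply: eq_bigr => i _; exact: muleC.
- by move=> j; rewrite mule_ge0// lee_fin.
- move=> j; apply: sume_ge0 => i _; rewrite mule_ge0//.
  by case: ifP => // _; exact: passage_ge0.
- move=> i j; rewrite mule_ge0//.
  by case: ifP => // _; exact: passage_ge0.
Qed.

Definition passage_gf (s : R) (n D : nat) : \bar R :=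
  (\sum_(i < n) (s ^+ i.+1)%:E * passage i D)%E.

Lemma passage_gf_ge0 s n D : 0 <= s -> (0 <= passage_gf s n D)%E.
Proof.
move=> s0; apply: sume_ge0 => i _.
by rewrite mule_ge0 ?passage_ge0// lee_fin exprn_ge0.
Qed.

(** First-step analysis: one step costs a factor s, and the transform is 1 at
    a record. *)
Lemma passage_gfS s n D : 0 <= s -> passage_gf s n.+1 D =
  (s%:E * avg (fun j => if is_record D j then 1 else
     passage_gf s n (next_gap D j)))%E.
Proof.
move=> s0; rewrite /passage_gf big_ord_recl/= expr1.
have -> : avg (fun j => if is_record D j then 1%E
    else \sum_(i < n) (s ^+ i.+1)%:E * passage i (next_gap D j))%E =
  (passage 0 D + \sum_(i < n) (s ^+ i.+1)%:E * passage i.+1 D)%E.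
  have nn i j : (0 <= (if is_record D j then 0 else passage i (next_gap D j)))%E.
    by case: ifP => // _; exact: passage_ge0.
  under [in RHS]eq_bigr => i _ do rewrite [passage i.+1 D]/= -avgZ//.
  rewrite -(@avg_sum n (fun i j => (s ^+ i.+1)%:E *
    (if is_record D j then 0 else passage i (next_gap D j)))%E); last first.
    by move=> i j; rewrite mule_ge0// lee_fin exprn_ge0.
  rewrite [passage 0 D]/= -avgD.
  - apply: eq_avg => j; case: ifP => _.
      by rewrite big1 ?adde0// => i _; rewrite mule0.
    by rewrite add0e.
  - by move=> j; rewrite lee_fin.
  - move=> j; apply: sume_ge0 => i _.
    by rewrite mule_ge0// lee_fin exprn_ge0.
have t0 i : (0 <= (s ^+ i.+1)%:E * passage i.+1 D)%E.
  by rewrite mule_ge0 ?passage_ge0// lee_fin exprn_ge0.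
rewrite ge0_muleDr ?passage_ge0//; last by rewrite sume_ge0.
congr (_ + _)%E; rewrite ge0_sume_distrr//.
by apply: eq_bigr => i _; rewrite /bump/= muleA -EFinM -exprS.
Qed.

End records.

(** * Generating functions of the first record time *)

Definition right_step (j : nat) : int := 1 - j%:Z.
Definition left_step (j : nat) : int := j%:Z - 1.

Lemma right_recordS D j : is_record right_step D.+1 j = (D + j == 0)%N.
Proof. rewrite /is_record /reaches /right_step; lia. Qed.

Lemma right_nextS D j : next_gap right_step D.+1 j = (D + j)%N.
Proof. rewrite /next_gap /gap_after /right_step; lia. Qed.

Lemma right_record0 j : is_record right_step 0 j = (j <= 1)%N.
Proof. rewrite /is_record /reaches /right_step; lia. Qed.

Lemma right_next0 j : (1 < j)%N -> next_gap right_step 0 j = j.-1.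
Proof. rewrite /next_gap /gap_after /right_step; lia. Qed.

Lemma left_record D j : is_record left_step D j = (D < j)%N.
Proof. rewrite /is_record /reaches /left_step; lia. Qed.

Lemma left_next D j : (j <= D)%N -> next_gap left_step D j = (D - j).+1.
Proof. rewrite /next_gap /gap_after /left_step; lia. Qed.

Section generating_functions.
Context (R : realType) (q : R) (p : nat -> R).
Hypothesis hq : 0 < q.
Hypothesis hp : forall n, 0 <= p n.
Hypothesis hqp : (q%:E + \sum_(0 <= n <oo) (p n)%:E = 1)%E.

Local Notation w := (step_weight q p).
Local Notation phi := (phi q p).
Local Notation h := (h q p).
Let w_ge0 := weight_ge0 hq hp.
Let w_sum := weight_series hq hp hqp.
Context (s : R).
Hypothesis s0 : 0 < s.
Hypothesis s1 : s < 1.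

Let hs0 := h_gt0 hq hp hqp s0 s1.
Let hs1 := h_lt1 hq hp hqp s0 s1.

Lemma avg_pow : avg w (fun j => (h s ^+ j)%:E) = (phi (h s))%:E.
Proof.
rewrite -(phi_series hq hp hqp); last by rewrite ltW ?hs0// ltW ?hs1.
by apply: eq_eseriesr => j _; rewrite EFinM.
Qed.

Lemma avg_at0 (c : R) : 0 <= c -> avg w (fun j => ((j == 0%N)%:R * c)%:E) = (q * c)%:E.
Proof.
move=> c0; rewrite /avg nneseries_recl//; last first.
  by move=> j _; rewrite mule_ge0// lee_fin ?w_ge0 ?mulr_ge0.
rewrite mul1r EFinM [X in (_ + X)%E](_ : _ = 0%E) ?adde0//.
rewrite -(@nneseries_addn _ (fun j => (w j)%:E * ((j == 0%N)%:R * c)%:E)%E 1%N).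
  by rewrite eseries0// => j _ _; rewrite addn1 mul0r mule0.
by move=> j; rewrite mule_ge0// lee_fin ?w_ge0 ?mulr_ge0.
Qed.

Local Notation gfr := (passage_gf w right_step s).

(** From a gap D > 0 a record can only be reached through gap 1 by a step +1,
    without overshoot, and h ^+ D is invariant under one discounted step as
    h = s phi(h). The error s ^+ n accounts for the paths that have not yet
    produced a record. *)
Lemma right_passage_pos n D :
  (gfr n D.+1 <= (h s ^+ D.+1)%:E <= gfr n D.+1 + (s ^+ n)%:E)%E.
Proof.
have hX k : 0 <= h s ^+ k by rewrite exprn_ge0// ltW.
elim: n D => [|n IH] D.
  rewrite /passage_gf big_ord0 add0e !lee_fin hX expr0/=.
  by rewrite exprn_ile1// ltW.
have hD : ((h s ^+ D.+1)%:E = s%:E * avg w (fun j => (h s ^+ (D + j))%:E))%E.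
  under eq_avg do rewrite exprD EFinM.
  by rewrite avgZ// avg_pow -!EFinM mulrCA -(h_fix hq hp hqp s0 s1) -exprSr.
rewrite (passage_gfS right_step w_ge0)//; last exact: ltW.
have g0 m D' := passage_gf_ge0 right_step w_ge0 m D' (ltW s0).
rewrite hD; apply/andP; split.
  rewrite lee_wpmul2l ?lee_fin ?(ltW s0)//; apply: le_avg => // j.
    by case: ifP.
  rewrite right_recordS right_nextS; case: (D + j)%N => [|k]/=.
    by rewrite expr0.
  by have /andP[] := IH k.
have -> : ((s ^+ n.+1)%:E = s%:E * avg w (fun=> (s ^+ n)%:E))%E.
  by rewrite avg_cst// -EFinM exprS.
have sn j : (0 <= (if is_record right_step D.+1 j then 1
    else gfr n (next_gap right_step D.+1 j)))%E by case: ifP.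
rewrite -ge0_muleDr ?avg_ge0//; last 1 first.
  by move=> j; rewrite lee_fin exprn_ge0// ltW.
rewrite lee_wpmul2l ?lee_fin ?(ltW s0)//.
rewrite -avgD//; last by move=> j; rewrite lee_fin exprn_ge0// ltW.
apply: le_avg => // j; first by rewrite lee_fin.
rewrite right_recordS right_nextS; case: (D + j)%N => [|k]/=.
  by rewrite expr0 leeDl// lee_fin exprn_ge0// ltW.
by have /andP[] := IH k.
Qed.

Let jump (j : nat) : \bar R := if (j <= 1)%N then 1%E else (h s ^+ j.-1)%:E.

Let jump_ge0 j : (0 <= jump j)%E.
Proof. by rewrite /jump; case: ifP => _; rewrite lee_fin// exprn_ge0// ltW. Qed.

Let jump_avg : (s%:E * avg w jump = (gf_right q p s)%:E)%E.
Proof.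
have hX k : 0 <= h s ^+ k by rewrite exprn_ge0// ltW.
(* After multiplication by h, the summand of avg w jump differs from h ^+ j
   only at j = 0; the terms are arranged so that no subtraction occurs. *)
have E : ((h s)%:E * avg w jump + q%:E = (phi (h s))%:E + (q * h s)%:E)%E.
  have qE := avg_at0 ler01; rewrite mulr1 in qE.
  rewrite -[q%:E]qE -(avg_at0 (ltW hs0)) -avg_pow.
  rewrite -avgZ// -!avgD//.
  all: try by move=> j; rewrite ?mule_ge0 ?lee_fin ?mulr_ge0 ?jump_ge0 ?(ltW hs0) ?hX.
  apply: eq_avg => j; rewrite /jump; case: j => [|[|j]]/=.
  - by rewrite mule1 expr0 !mul1r addeC.
  - by rewrite mule1 expr1 !mul0r.
  - by rewrite !mul0r !adde0 -EFinM -exprS.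
have a0 := avg_ge0 w_ge0 jump_ge0.
have a1 : (avg w jump <= 1)%E.
  apply: avg_le1 => // j; rewrite jump_ge0/= /jump; case: ifP => // _.
  by rewrite lee_fin exprn_ile1// ltW.
move: E; rewrite -(@fineK _ (avg w jump)); last first.
  by rewrite ge0_fin_numE// (le_lt_trans a1)// ltry.
rewrite -!EFinM -!EFinD => -[]; set a := fine _ => E.
congr EFin; have := h_fix hq hp hqp s0 s1.
move: (phi _) E => ph E hE.
have aE : a = (ph + q * h s - q) / h s.
  by apply: (mulfI (lt0r_neq0 hs0)); rewrite mulrCA divff ?lt0r_neq0// mulr1 -E addrK.
rewrite aE /gf_right mulrA !mulrBr mulrDr -hE !mulrBl mulrDl divff ?lt0r_neq0//.
by rewrite mulrA mulfK ?lt0r_neq0// [s * q]mulrC.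
Qed.

(** From gap 0 the first step either is a record (steps 1 and 0) or leads to
    the gap j - 1 > 0, to which right_passage_pos applies. *)
Lemma right_passage_gf n :
  (gfr n.+1 0 <= (gf_right q p s)%:E <= gfr n.+1 0 + (s ^+ n.+1)%:E)%E.
Proof.
have g0 m D' := passage_gf_ge0 right_step w_ge0 m D' (ltW s0).
rewrite (passage_gfS right_step w_ge0)//; last exact: ltW.
have sn j : (0 <= (if is_record right_step 0 j then 1
    else gfr n (next_gap right_step 0 j)))%E by case: ifP.
rewrite -jump_avg; apply/andP; split.
  rewrite lee_wpmul2l ?lee_fin ?(ltW s0)//; apply: le_avg => // j.
  rewrite right_record0 /jump; case: leqP => // j1; rewrite right_next0//.
  case: j j1 => [|[|j]]// _; by have /andP[] := right_passage_pos n j.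
have -> : ((s ^+ n.+1)%:E = s%:E * avg w (fun=> (s ^+ n)%:E))%E.
  by rewrite avg_cst// -EFinM exprS.
rewrite -ge0_muleDr ?avg_ge0//; last 1 first.
  by move=> j; rewrite lee_fin exprn_ge0// ltW.
rewrite lee_wpmul2l ?lee_fin ?(ltW s0)//.
rewrite -avgD//; last by move=> j; rewrite lee_fin exprn_ge0// ltW.
apply: le_avg => // j.
rewrite right_record0 /jump; case: leqP => j1.
  by rewrite leeDl// lee_fin exprn_ge0// ltW.
rewrite right_next0//; case: j j1 => [|[|j]]// _.
by have /andP[] := right_passage_pos n j.
Qed.

Local Notation surv := (survival w left_step).

(** Dual to the right continuous case: h ^+ D, used as a weight on the
    starting gap, is a left eigenvector of the chain killed at records, up to
    the mass that sits at gap 0. *)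
Definition left_potential (n : nat) : \bar R := (\sum_(0 <= D <oo) (h s ^+ D)%:E * surv n D)%E.

Let surv_ge0 n D : (0 <= surv n D)%E.
Proof. by have /andP[] := survival_itv left_step w_ge0 w_sum n D. Qed.

Let term_ge0 n D : (0 <= (h s ^+ D)%:E * surv n D)%E.
Proof. by rewrite mule_ge0// lee_fin exprn_ge0// ltW. Qed.

Let geometric_sum : (\sum_(0 <= e <oo) (h s ^+ e)%:E = (1 - h s)^-1%:E)%E.
Proof.
apply: cvg_lim => //; apply/fine_cvgP; split.
  by near=> n; rewrite sumEFin.
under eq_fun do rewrite /= sumEFin/=.
have := @cvg_geometric_series R 1 (h s).
rewrite ger0_norm ?ltW// => /(_ hs1); rewrite div1r.
by apply: cvg_trans; apply: near_eq_cvg; near=> n; rewrite /series/=; apply: eq_bigr => i _; rewrite mul1r.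
Unshelve. all: end_near. Qed.

(** Summation by columns: the gaps e + 1 reached from D = e + j by the
    step j receive the weight h ^+ e * (w j * h ^+ j), and the sum over j is
    phi(h) = h / s. *)
Lemma potentialS n : left_potential n = (surv n 0 + s%:E * left_potential n.+1)%E.
Proof.
have hX k : 0 <= h s ^+ k by rewrite exprn_ge0// ltW.
rewrite {1}/left_potential nneseries_recl//= expr0 mul1e; congr (_ + _)%E.
rewrite -(@nneseries_addn _ (fun D => (h s ^+ D)%:E * surv n D)%E 1%N)//.
have -> : left_potential n.+1 = (\sum_(0 <= D <oo) \sum_(0 <= j <oo)
    (if (D < j)%N then 0 else (w j * h s ^+ D)%:E * surv n (D - j).+1))%E.
  apply: eq_eseriesr => D _; rewrite [surv n.+1 D]/= -avgZ//; last first.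
    by move=> j; case: ifP.
  apply: eq_eseriesr => j _; rewrite left_record; case: ltnP => jD.
    by rewrite !mule0.
  by rewrite left_next// muleA -EFinM.
pose Y := (\sum_(0 <= e <oo) (h s ^+ e)%:E * surv n e.+1)%E.
rewrite nneseries_interchange; last first.
  by move=> i j; case: ifP => // _; rewrite mule_ge0// lee_fin mulr_ge0.
have -> : (\sum_(0 <= j <oo) \sum_(0 <= D <oo)
    (if (D < j)%N then 0 else (w j * h s ^+ D)%:E * surv n (D - j).+1) =
   \sum_(0 <= j <oo) (w j * h s ^+ j)%:E * Y)%E.
  apply: eq_eseriesr => j _.
  rewrite -nneseriesZl; last by move=> e _; rewrite mule_ge0// lee_fin.
  rewrite (nneseries_split 0 j); last first.
    by move=> D _; case: ifP => // _; rewrite mule_ge0// lee_fin mulr_ge0.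
  rewrite add0n big_nat_cond big1 ?add0e; last first.
    by move=> D /andP[/andP[_ ->]].
  rewrite -(@nneseries_addn _ (fun D => if (D < j)%N then 0%E else
    ((w j * h s ^+ D)%:E * surv n (D - j).+1)%E) j); last first.
    by move=> D; case: ifP => // _; rewrite mule_ge0// lee_fin mulr_ge0.
  apply: eq_eseriesr => e _; rewrite ltnNge leq_addl/= addnK muleA -EFinM.
  by rewrite exprD -mulrA [h s ^+ e * _]mulrC.
have -> : (\sum_(0 <= j <oo) (w j * h s ^+ j)%:E * Y = (phi (h s))%:E * Y)%E.
  have Y0 : (0 <= Y)%E by apply: nneseries_ge0 => e _ _; rewrite mule_ge0// lee_fin.
  have Yfin : Y \is a fin_num.
    rewrite ge0_fin_numE//; apply: le_lt_trans (ltry (1 - h s)^-1).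
    rewrite -geometric_sum; apply: lee_nneseries => e _.
      by rewrite mule_ge0// lee_fin.
    rewrite -[leRHS]mule1 lee_wpmul2l ?lee_fin//.
    by have /andP[] := survival_itv left_step w_ge0 w_sum n e.+1.
  rewrite -(fineK Yfin) -avg_pow muleC -nneseriesZl; last first.
    by move=> j _; rewrite mule_ge0// lee_fin.
  by apply: eq_eseriesr => j _; rewrite EFinM [RHS]muleC.
rewrite muleA -EFinM -(h_fix hq hp hqp s0 s1) -nneseriesZl; last first.
  by move=> e _; rewrite mule_ge0// lee_fin.
by apply: eq_eseriesr => e _; rewrite addn1 muleA -EFinM -exprS.
Qed.

(** Iteration of potentialS, from U_0 = 1 / (1 - h). *)
Lemma left_survival_gf n :
  (\sum_(i < n) (s ^+ i)%:E * surv i 0 + (s ^+ n)%:E * left_potential n =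
    (1 - h s)^-1%:E)%E.
Proof.
elim: n => [|n IH].
  rewrite big_ord0 add0e expr0 mul1e -geometric_sum.
  by apply: eq_eseriesr => D _; rewrite /= mule1.
rewrite -IH big_ord_recr/= -addeA; congr (_ + _)%E.
have p0 : (0 <= left_potential n.+1)%E by apply: nneseries_ge0.
rewrite [in RHS]potentialS ge0_muleDr//; last by rewrite mule_ge0// lee_fin ltW.
by rewrite muleA -EFinM -exprSr.
Qed.

Lemma potential_itv n : (0 <= left_potential n <= (1 - h s)^-1%:E)%E.
Proof.
apply/andP; split; first by apply: nneseries_ge0.
rewrite -geometric_sum; apply: lee_nneseries => // D _.
rewrite -[leRHS]mule1 lee_wpmul2l ?lee_fin ?exprn_ge0 ?(ltW hs0)//.
by have /andP[] := survival_itv left_step w_ge0 w_sum n D.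
Qed.


End generating_functions.

(** * Rates for the two skip-free walks *)

Section real_valued.
Context (R : realType) (w : nat -> R) (x : nat -> int).
Hypothesis w_ge0 : forall j, 0 <= w j.
Hypothesis w_sum : (\sum_(0 <= j <oo) (w j)%:E = 1)%E.

Definition passage_prob (i : nat) : R := fine (passage w x i 0).
Definition survival_prob (i : nat) : R := fine (survival w x i 0).
Definition record_prob (k n : nat) : R := fine (record_law w x n 0 k).

Lemma survival_probE i : survival w x i 0 = (survival_prob i)%:E.
Proof.
have /andP[v0 v1] := survival_itv x w_ge0 w_sum i 0.
by rewrite fineK// ge0_fin_numE// (le_lt_trans v1)// ltry.
Qed.

Lemma passage_probE i : passage w x i 0 = (passage_prob i)%:E.
Proof.
have g0 := passage_ge0 x w_ge0 i 0.
rewrite fineK// ge0_fin_numE//; apply: (@le_lt_trans _ _ 1%E); last exact: ltry.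
have /andP[_] := survival_itv x w_ge0 w_sum i 0; apply: le_trans.
rewrite (survivalS x w_ge0 w_sum) leeDl//.
by have /andP[] := survival_itv x w_ge0 w_sum i.+1 0.
Qed.

Lemma record_probE k n : record_law w x n 0 k = (record_prob k n)%:E.
Proof.
have /andP[v0 v1] := record_law_itv x w_ge0 w_sum n 0 k.
by rewrite fineK// ge0_fin_numE// (le_lt_trans v1)// ltry.
Qed.

Lemma passage_prob_ge0 i : 0 <= passage_prob i.
Proof. exact/fine_ge0/passage_ge0. Qed.

Lemma survival_prob_ge0 i : 0 <= survival_prob i.
Proof. by apply: fine_ge0; have /andP[] := survival_itv x w_ge0 w_sum i 0. Qed.

Lemma survival_prob_le1 i : survival_prob i <= 1.
Proof.
rewrite -lee_fin -survival_probE.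
by have /andP[] := survival_itv x w_ge0 w_sum i 0.
Qed.

Lemma survival_probS i : survival_prob i = passage_prob i + survival_prob i.+1.
Proof.
by apply: EFin_inj; rewrite EFinD -!survival_probE -passage_probE -survivalS.
Qed.

Lemma passage_prob_sum_le1 n : \sum_(i < n) passage_prob i <= 1.
Proof.
rewrite -lee_fin -(passage_sum x w_ge0 w_sum n 0) -sumEFin.
under eq_bigr do rewrite -passage_probE.
by rewrite leeDl//; have /andP[] := survival_itv x w_ge0 w_sum n 0.
Qed.

Lemma record_prob0 n : record_prob 0 n = 1.
Proof. by rewrite /record_prob record_law0. Qed.

Lemma record_probS k n : record_prob k.+1 n =
  \sum_(i < n) passage_prob i * record_prob k (n - i.+1).
Proof.
apply: EFin_inj; rewrite -record_probE (record_law_renewal x w_ge0 w_sum) -sumEFin.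
by apply: eq_bigr => i _; rewrite EFinM -passage_probE -record_probE.
Qed.

Lemma passage_gfE s n :
  passage_gf w x s n 0 = (\sum_(i < n) passage_prob i * s ^+ i.+1)%:E.
Proof.
rewrite -sumEFin; apply: eq_bigr => i _.
by rewrite EFinM -passage_probE muleC.
Qed.

(** Summation by parts, as f_i = v_i - v_(i+1). *)
Lemma passage_survival_sum s n : \sum_(i < n) passage_prob i * s ^+ i.+1 =
  1 - (1 - s) * \sum_(i < n) s ^+ i * survival_prob i - s ^+ n * survival_prob n.
Proof.
elim: n => [|n IH].
  rewrite !big_ord0 mulr0 subr0 expr0 mul1r.
  by rewrite /survival_prob/= subrr.
rewrite !big_ord_recr/= IH (survival_probS n) exprS; ring.
Qed.

End real_valued.

Section rates.
Context (R : realType) (q : R) (p : nat -> R).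
Hypothesis hq : 0 < q.
Hypothesis hp : forall n, 0 <= p n.
Hypothesis hqp : (q%:E + \sum_(0 <= n <oo) (p n)%:E = 1)%E.
Hypothesis hphi : left_derivative_at (phi q p) 1 1.

Local Notation w := (step_weight q p).
Let w_ge0 := weight_ge0 hq hp.
Let w_sum := weight_series hq hp hqp.

Lemma cvg_geometric_error (u : nat -> R) (l C s : R) : 0 < s -> s < 1 ->
  (forall n, `|u n - l| <= C * s ^+ n) -> u n @[n --> \oo] --> l.
Proof.
move=> s0 s1 ul; apply/subr_cvg0.
apply: norm_cvg0.
apply: (squeeze_cvgr (f := fun=> 0) (h := fun n => C * s ^+ n)).
- by near=> n; rewrite normr_ge0 ul.
- exact: cvg_cst.
- rewrite -[X in _ --> X](mulr0 C); apply: cvgMr; apply: cvg_expr.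
  by rewrite ger0_norm// ltW.
Unshelve. all: end_near. Qed.

Lemma right_passage_cvg s : 0 < s -> s < 1 ->
  \sum_(i < n) passage_prob w right_step i * s ^+ i.+1 @[n --> \oo] -->
    gf_right q p s.
Proof.
move=> s0 s1.
rewrite -(cvg_shiftS (fun n => \sum_(i < n) passage_prob w right_step i * s ^+ i.+1))/=.
apply: (@cvg_geometric_error _ _ s s) => // n.
have := right_passage_gf hq hp hqp s0 s1 n.
rewrite (passage_gfE right_step w_ge0 w_sum) -EFinD !lee_fin -exprS => /andP[h1 h2].
by rewrite distrC ger0_norm ?subr_ge0// lerBlDl.
Qed.

Lemma left_passage_cvg s : 0 < s -> s < 1 ->
  \sum_(i < n) passage_prob w left_step i * s ^+ i.+1 @[n --> \oo] -->
    gf_left q p s.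
Proof.
move=> s0 s1; have hs1 := h_lt1 hq hp hqp s0 s1.
set a := (1 - h q p s)^-1.
have a0 : 0 < a by rewrite invr_gt0 subr_gt0.
apply: (@cvg_geometric_error _ _ (a + 1) s) => // n.
have E := left_survival_gf hq hp hqp s0 s1 n.
have /andP[] := potential_itv hq hp hqp s0 s1 n.
move: E; case: (left_potential _ _ _ _) => [U| |]//.
have -> : (\sum_(i < n) (s ^+ i)%:E * survival w left_step i 0 =
    (\sum_(i < n) s ^+ i * survival_prob w left_step i)%:E)%E.
  rewrite -sumEFin; apply: eq_bigr => i _.
  by rewrite (survival_probE left_step w_ge0 w_sum) EFinM.
rewrite -EFinM -EFinD !lee_fin -/a => -[] E U0 Ua.
rewrite (passage_survival_sum left_step w_ge0 w_sum).
have -> : gf_left q p s = 1 - (1 - s) * a.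
  have := h_chord hq hp hqp s0 s1; rewrite /gf_left => hc.
  by rewrite -hc mulrAC mulfV ?mul1r ?subKr// subr_eq0 gt_eqF.
have v0 := survival_prob_ge0 left_step w_ge0 w_sum n.
have v1 := survival_prob_le1 left_step w_ge0 w_sum n.
set v := survival_prob _ _ n in v0 v1 *.
set S := \sum_(i < n) _ in E *.
have -> : 1 - (1 - s) * S - s ^+ n * v - (1 - (1 - s) * a) =
    ((1 - s) * U - v) * s ^+ n by rewrite -E; ring.
rewrite normrM [`|s ^+ n|]ger0_norm ?exprn_ge0 ?(ltW s0)//.
rewrite ler_wpM2r ?exprn_ge0 ?(ltW s0)// ler_norml.
have : 0 <= (1 - s) * U by rewrite mulr_ge0// subr_ge0 ltW.
have : (1 - s) * U <= U by rewrite ler_piMl// gerBl ltW.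
by move=> h1 h2; apply/andP; split; lra.
Qed.

Lemma right_passage0 : 0 < passage_prob w right_step 0.
Proof.
apply: lt_le_trans hq _; rewrite -lee_fin -(passage_probE right_step w_ge0 w_sum)/=.
have := avg_at0 hq hp ler01; rewrite mulr1 => <-.
apply: (le_avg w_ge0) => j; first by rewrite lee_fin mulr1.
by rewrite lee_fin right_record0 mulr1 ler_nat; case: j => [|[]].
Qed.

Lemma left_passage0 : 0 < passage_prob w left_step 0.
Proof.
have E : (avg w (fun j => ((j == 0%N)%:R * 1)%:E) + passage w left_step 0 0 = 1)%E.
  rewrite [passage w _ 0 0]/= -avgD//.
  rewrite -[RHS](avg1 w_sum); apply: eq_avg => j.
  by rewrite left_record; case: j => [|j]/=; rewrite !mulr1 ?adde0 ?add0e.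
move: E; rewrite (avg_at0 hq hp ler01) (passage_probE left_step w_ge0 w_sum).
rewrite -EFinD => -[] E; have := q_lt1 hq hp hqp hphi; lra.
Qed.

Theorem right_record_rate (y : R) (r : nat -> nat) : 0 < y ->
  (forall n, y * n%:R <= (r n)%:R < y * n%:R + 1) ->
  ((n%:R^-1)%:E * lne (record_law w right_step n 0 (r n)))%E @[n --> \oo] -->
    (- (y%:E * legendre (Lambda_r q p) (1 / y)%R))%E.
Proof.
move=> y0 ry; under eq_fun do rewrite (record_probE right_step w_ge0 w_sum).
apply: (renewal_rate (passage_prob_ge0 right_step w_ge0) right_passage0
  (passage_prob_sum_le1 right_step w_ge0 w_sum) right_passage_cvg) => //.
- exact: gf_right_to1.
- exact: gf_right_steep.
- by move=> n; exact: record_prob0.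
- exact: record_probS.
- exact: Lambda_r0.
Qed.

Theorem left_record_rate (y : R) (r : nat -> nat) : 0 < y ->
  (forall n, y * n%:R <= (r n)%:R < y * n%:R + 1) ->
  ((n%:R^-1)%:E * lne (record_law w left_step n 0 (r n)))%E @[n --> \oo] -->
    (- (y%:E * legendre (Lambda_l q p) (1 / y)%R))%E.
Proof.
move=> y0 ry; under eq_fun do rewrite (record_probE left_step w_ge0 w_sum).
apply: (renewal_rate (passage_prob_ge0 left_step w_ge0) left_passage0
  (passage_prob_sum_le1 left_step w_ge0 w_sum) left_passage_cvg) => //.
- exact: gf_left_to1.
- exact: gf_left_steep.
- by move=> n; exact: record_prob0.
- exact: record_probS.
- by rewrite /Lambda_l eqxx.
- exact: Lambda_lE.
Qed.

End rates.

(** * The law of the number of records *)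

(** The number of records among the n steps X i, ..., X (i + n - 1) of a
    walk whose gap before step i is D. *)
Fixpoint record_count (X : nat -> int) (i n D : nat) : nat :=
  if n is n'.+1 then
    if reaches D (X i) then (record_count X i.+1 n' 0).+1
    else record_count X i.+1 n' (gap_after D (X i))
  else 0.

Section law_of_the_records.
Context d (Omega : measurableType d) (R : realType) (P : probability Omega R).
Variable X : nat -> {RV P >-> int}.

Let records_ge (i n D k : nat) : set Omega :=
  [set v | (k <= record_count (X ^~ v) i n D)%N].

Let records_ge_split i n D k z :
  records_ge i n.+1 D k `&` X i @^-1` [set z] =
  (if reaches D z then records_ge i.+1 n 0 k.-1
   else records_ge i.+1 n (gap_after D z) k) `&` X i @^-1` [set z].
Proof.
apply/seteqP; split => v [h E]; move: (E) h; rewrite /= => E'; rewrite -E' /records_ge/= => h; split => //.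
  by move: h; case: ifP => _ //=; case: k.
by move: h; case: ifP => _ //=; case: k.
Qed.

Let measurable_step i z : measurable (X i @^-1` [set z]).
Proof. exact: measurable_funPTI. Qed.

Let measurable_records_ge i n D k : measurable (records_ge i n D k).
Proof.
elim: n i D k => [|n IH] i D k.
  rewrite /records_ge/=; case: k => [|k].
    by rewrite (_ : [set _ | _] = setT)//; apply/seteqP; split.
  by rewrite (_ : [set _ | _] = set0)//; apply/seteqP; split.
have -> : records_ge i n.+1 D k =
    \bigcup_(z : int) (records_ge i n.+1 D k `&` X i @^-1` [set z]).
  rewrite -setI_bigcupr (_ : \bigcup_z _ = setT) ?setIT//.
  by apply/seteqP; split => // v _; exists (X i v).
apply: countable_bigcupT_measurable => // z.
rewrite records_ge_split; apply: measurableI => //.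
by case: ifP => _; exact: IH.
Qed.

Variables (w : nat -> R) (x : nat -> int).
Hypothesis w_ge0 : forall j, 0 <= w j.
Hypothesis w_sum : (\sum_(0 <= j <oo) (w j)%:E = 1)%E.
Hypothesis x_inj : injective x.
Hypothesis XP : forall i j, P (X i @^-1` [set x j]) = (w j)%:E.
Hypothesis X_indep : mutually_independent X.

Let trivIset_step i : trivIset [set: nat] (fun j => X i @^-1` [set x j]).
Proof.
by move=> j k _ _ [v /= []]; rewrite /preimage/= => -> /x_inj.
Qed.

(** The values x j exhaust the law of each step. *)
Lemma probability_by_step i A : measurable A ->
  P A = (\sum_(0 <= j <oo) P (A `&` X i @^-1` [set x j]))%E.
Proof.
move=> mA; pose B := \bigcup_j (X i @^-1` [set x j]).
have mB : measurable B by apply: bigcupT_measurable.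
have PB : P B = 1%E.
  rewrite measure_semi_bigcup// -[RHS]w_sum.
  by apply: eq_eseriesr => j _; exact: XP.
have AB : P (A `&` ~` B) = 0%E.
  apply/eqP; rewrite eq_le measure_ge0 andbT.
  apply: (@le_trans _ _ (P (~` B))).
    have mCB := measurableC mB.
    by apply: le_measure; rewrite ?inE//; exact: measurableI.
  by rewrite probability_setC// PB subee.
rewrite -[A in LHS]setIT -(setUv B) setIUr measureU.
- rewrite [X in (_ + X)%E](_ : _ = 0%E); last exact: AB.
  rewrite adde0 /B setI_bigcupr; apply: measure_semi_bigcup.
  + by move=> j; exact: measurableI.
  + by apply: trivIset_setIl.
  + by rewrite -setI_bigcupr; exact: measurableI.
- exact: measurableI.
- by apply: measurableI => //; exact: measurableC.
- by rewrite setIACA setICr setI0.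
Qed.

Let cylinder (i : nat) (c : nat -> nat) : set Omega :=
  [set v | forall l, (l < i)%N -> X l v = x (c l)].

Let cylinderP i c : P (cylinder i c) = (\prod_(l < i) w (c l))%:E.
Proof.
have := X_indep (fun l => [set x (c l)]) (iota_uniq 0 i).
have -> : [set v | forall l, l \in iota 0 i -> [set x (c l)] (X l v)] = cylinder i c.
  by apply/seteqP; split => v H l /=; have := H l; rewrite mem_iota add0n.
move=> ->; rewrite -prodEFin -(big_mkord xpredT (fun l => (w (c l))%:E)).
by rewrite /index_iota subn0; apply: eq_bigr => l _; rewrite XP.
Qed.

Let cylinder_snoc i c j : cylinder i c `&` X i @^-1` [set x j] =
  cylinder i.+1 (fun l => if l == i then j else c l).
Proof.
apply/seteqP; split => v.
  move=> [H Hj] l; rewrite ltnS leq_eqVlt => /predU1P[->|li].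
    by rewrite eqxx.
  by rewrite ltn_eqF// H.
move=> H; split => [l li|].
  by have := H l (ltnW li); rewrite ltn_eqF.
by have := H i (ltnSn i); rewrite eqxx.
Qed.

Let measurable_cylinder i c : measurable (cylinder i c).
Proof.
elim: i => [|i IH].
  by rewrite (_ : cylinder 0 c = setT)//; apply/seteqP; split.
have := cylinder_snoc i c (c i).
have -> : cylinder i.+1 (fun l => if l == i then c i else c l) = cylinder i.+1 c.
  by apply/seteqP; split => v H l li; have := H l li; case: eqP => // ->.
by move=> <-; exact: measurableI.
Qed.

(** Conditioning on the values of the first i steps is what makes the
    induction on n go through: after one more step is revealed, the remaining
    records are again counted from a known gap. *)
Let cylinder_records i n D k c : P (cylinder i c `&` records_ge i n D k) =
  ((\prod_(l < i) w (c l))%:E * record_law w x n D k)%E.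
Proof.
elim: n i D k c => [|n IH] i D k c /=.
  rewrite /records_ge/=; case: k => [|k].
    by rewrite (_ : [set _ | _] = setT) ?setIT ?cylinderP ?mule1//; apply/seteqP; split.
  rewrite (_ : [set _ | _] = set0) ?setI0 ?measure0 ?mule0//.
  by apply/seteqP; split.
rewrite (probability_by_step i); last exact: measurableI.
have W0 : 0 <= \prod_(l < i) w (c l) by apply: prodr_ge0.
rewrite /avg -nneseriesZl; last first.
  move=> j _; rewrite mule_ge0 ?lee_fin//; case: ifP => _.
    by have /andP[] := record_law_itv x w_ge0 w_sum n 0 k.-1.
  by have /andP[] := record_law_itv x w_ge0 w_sum n (next_gap x D j) k.
apply: eq_eseriesr => j _.
pose c' l := if l == i then j else c l.
have -> : cylinder i c `&` records_ge i n.+1 D k `&` X i @^-1` [set x j] =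
    cylinder i.+1 c' `&` (if is_record x D j then records_ge i.+1 n 0 k.-1
      else records_ge i.+1 n (next_gap x D j) k).
  rewrite -setIA records_ge_split setIA setIAC cylinder_snoc//.
have W : \prod_(l < i.+1) w (c' l) = (\prod_(l < i) w (c l)) * w j.
  rewrite big_ord_recr/= /c' eqxx; congr (_ * _).
  by apply: eq_bigr => l _; rewrite ltn_eqF.
by case: ifP => _; rewrite IH W EFinM muleA.
Qed.

Lemma record_count_law n k :
  P [set v | (k <= record_count (X ^~ v) 0 n 0)%N] = record_law w x n 0 k.
Proof.
have := cylinder_records 0 n 0 k id; rewrite big_ord0 mul1e => <-.
by congr (P _); apply/seteqP; split => v /=; [split|case].
Qed.

End law_of_the_records.

(** * Record times along a path *)

Section paths.
Context d (Omega : measurableType d) (R : realType) (P : probability Omega R).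
Variable X : nat -> {RV P >-> int}.
Variable v : Omega.

Let M n : int := walk_max X n v.
Let S n : int := walk X n v.

Lemma walkS n : S n.+1 = S n + X n v.
Proof. by rewrite /S /walk big_ord_recr. Qed.

Lemma walk_maxS n : M n.+1 = Order.max (M n) (S n.+1).
Proof.
apply/le_anti/andP; split.
  apply/bigmax_leP; split => [|i _]; rewrite le_max.
    by rewrite (le_bigmax _ (fun m : 'I_n.+1 => walk X m v) ord0).
  have [->|lt_in] := eqVneq (i : nat) n.+1; first by rewrite lexx orbT.
  have li : (i < n.+1)%N by have := ltn_ord i; rewrite ltnS leq_eqVlt (negPf lt_in).
  by rewrite (le_bigmax _ (fun m : 'I_n.+1 => walk X m v) (Ordinal li)).
rewrite ge_max (le_bigmax _ (fun m : 'I_n.+2 => walk X m v) ord_max) andbT.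
apply/bigmax_leP; split => [|i _].
  exact: (le_bigmax _ (fun m : 'I_n.+2 => walk X m v) ord0).
exact: (le_bigmax _ (fun m : 'I_n.+2 => walk X m v) (widen_ord (leqnSn _) i)).
Qed.

Lemma walk_le_max n : S n <= M n.
Proof. exact: (le_bigmax _ (fun m : 'I_n.+1 => walk X m v) ord_max). Qed.

Lemma walk_max0 : M 0 = S 0.
Proof.
apply/le_anti; rewrite walk_le_max andbT.
by apply/bigmax_leP; split => // i _; rewrite (ord1 i).
Qed.

Definition records n : nat :=
  \sum_(m < n) (walk_max X m v <= walk X m.+1 v)%R.

Lemma record_count_records i n :
  (record_count (X ^~ v) i n `|M i - S i| + records i = records (i + n))%N.
Proof.
elim: n i => [|n IH] i; first by rewrite addn0.
have gap : reaches `|M i - S i| (X i v) = (M i <= S i.+1).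
  rewrite /reaches gez0_abs ?subr_ge0 ?walk_le_max// walkS.
  by rewrite lerBlDr addrC.
have recS : records i.+1 = (records i + (M i <= S i.+1)%R)%N.
  by rewrite /records big_ord_recr.
rewrite /= gap addnS -addSn -IH recS walk_maxS.
case: (leP (M i) (S i.+1)) => h /=.
  by rewrite subrr addSn addn1 addnS.
rewrite addn0 /gap_after gez0_abs ?subr_ge0 ?walk_le_max//.
by rewrite walkS opprD addrA.
Qed.

Lemma record_countE n : record_count (X ^~ v) 0 n 0 = records n.
Proof.
have := record_count_records 0 n; rewrite walk_max0 subrr.
by rewrite {1}/records big_ord0 addn0.
Qed.

Lemma recordsS n : records n.+1 = (records n + (walk_max X n v <= walk X n.+1 v)%R)%N.
Proof. by rewrite /records big_ord_recr. Qed.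

Lemma records_homo m n : (m <= n)%N -> (records m <= records n)%N.
Proof.
move=> mn; rewrite -(subnK mn); elim: (n - m)%N => [//|k IH].
by rewrite addSn recordsS (leq_trans IH)// leq_addr.
Qed.

Lemma record_time_ge0 k : (0 <= record_time X k v)%E.
Proof.
case: k => [//|k] /=; apply/ereal_infP => _ [m _ <-].
by rewrite lee_fin.
Qed.

Lemma recordsP k n : reflect
  (exists m, [/\ (m < n)%N, (k <= records m)%N & walk_max X m v <= walk X m.+1 v])
  (k < records n)%N.
Proof.
apply: (iffP idP).
  elim: n => [|n IH]; first by rewrite /records big_ord0.
  rewrite recordsS; have [kn _|kn] := ltnP k (records n).
    by have [m [mn km mr]] := IH kn; exists m; split => //; exact: ltnW.
  case: (boolP (_ <= _)%R) => [mr|_]; last by rewrite addn0 ltnNge kn.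
  by rewrite addn1 ltnS => nk; exists n; split.
move=> [m [mn km mr]]; apply: leq_trans (records_homo mn).
by rewrite recordsS mr addn1.
Qed.

(** The strict form at n + 1 is proved together with the large one at n: it
    is what the condition that the next record be after time m - 1 unfolds to,
    and it shows that record times take no values between integers. *)
Lemma record_time_leP k n :
  ((record_time X k v <= n%:R%:E)%E <-> (k <= records n)%N) /\
  ((record_time X k v < n.+1%:R%:E)%E <-> (k <= records n)%N).
Proof.
elim: k n => [|k IH] n.
  by split; split => // _; rewrite /= ?lee_fin ?lte_fin.
suff [h1 h2] : ((record_time X k.+1 v < n.+1%:R%:E)%E -> (k < records n)%N) /\
    ((k < records n)%N -> (record_time X k.+1 v <= n%:R%:E)%E).
  have h3 : (record_time X k.+1 v <= n%:R%:E)%E -> (record_time X k.+1 v < n.+1%:R%:E)%E.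
    by move=> /le_lt_trans; apply; rewrite lte_fin ltr_nat.
  by split; split; auto.
split.
  move=> /ereal_inf_lt[_ [m [Tm mr] <-]]; rewrite lte_fin ltr_nat ltnS => mn.
  case: m Tm mr mn => [|m] Tm mr mn.
    by move: Tm; rewrite ltNge record_time_ge0.
  apply/recordsP; exists m; split => //.
  by apply/(IH m).2.
move=> /recordsP[m [mn km mr]].
apply: (@le_trans _ _ m.+1%:R%:E); last by rewrite lee_fin ler_nat.
apply: ereal_inf_lbound; exists m.+1 => //; split => //.
by apply/(IH m).2.
Qed.

Lemma record_numberE n : record_number X n v = (records n)%:R.
Proof.
rewrite /record_number.
have E : [set (k%:R : R) | k in [set k : nat |
    (1 <= k)%N /\ (record_time X k v <= n%:R%:E)%E]] =
  [set (k%:R : R) | k in [set k : nat | (1 <= k <= records n)%N]].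
  apply/seteqP; split => t [k /=].
    move=> [k1 kn] <-; exists k => //=; rewrite k1.
    exact: ((record_time_leP k n).1).1 kn.
  move=> /andP[k1 kn] <-; exists k => //=; split => //.
  exact: ((record_time_leP k n).1).2 kn.
rewrite E; have [r0|r0] := posnP (records n).
  rewrite r0 (_ : [set _ | _ in _] = set0) ?sup0//.
  by apply/seteqP; split => // t [k /=]; case: k.
apply/le_anti/andP; split.
  apply: ge_sup; first by exists (records n)%:R, (records n) => //=; rewrite r0 leqnn.
  by move=> _ [k /= /andP[_ kn] <-]; rewrite ler_nat.
apply: ub_le_sup.
  by exists (records n)%:R => _ [k /= /andP[_ kn] <-]; rewrite ler_nat.
by exists (records n) => //=; rewrite r0 leqnn.
Qed.

End paths.

(** * The theorem *)

Lemma record_number_law d (Omega : measurableType d) (R : realType)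
    (P : probability Omega R) (X : nat -> {RV P >-> int}) (w : nat -> R)
    (x : nat -> int) (y : R) (n : nat) :
  (forall j, 0 <= w j) -> (\sum_(0 <= j <oo) (w j)%:E = 1)%E -> injective x ->
  (forall i j, P (X i @^-1` [set x j]) = (w j)%:E) -> mutually_independent X ->
  0 < y ->
  P [set v | y * n%:R <= record_number X n v] =
  record_law w x n 0 `|Num.ceil (y * n%:R)|%N.
Proof.
move=> w0 w1 xI XP XI y0.
rewrite -(record_count_law w0 w1 xI XP XI).
congr (P _); apply/seteqP; split => v /=;
  by rewrite record_numberE record_countE -lez_nat gez0_abs ?ceil_ge0
    ?(lt_le_trans (ltrN10 _))// ?mulr_ge0 ?(ltW y0)// ceil_le_int.
Qed.

Lemma ceil_nat_itv (R : realType) (y : R) (n : nat) : 0 < y ->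
  y * n%:R <= (`|Num.ceil (y * n%:R)|%N)%:R < y * n%:R + 1.
Proof.
move=> y0.
have c0 : 0 <= Num.ceil (y * n%:R).
  by rewrite ceil_ge0 (lt_le_trans (ltrN10 _))// mulr_ge0// ltW.
rewrite natr_absz ger0_norm//.
by have /andP[] := ceil_itv (y * n%:R); rewrite intrB ltrBlDr => -> ->.
Qed.

Theorem theorem2p1 (d : measure_display) (Omega : measurableType d)
    (R : realType) (P : probability Omega R)
    (X : nat -> {RV P >-> int}) (hX : iid X)
    (q : R) (p : nat -> R) (hq : 0 < q) (hp : forall n, 0 <= p n)
    (hqp : (q%:E + \sum_(0 <= n <oo) (p n)%:E = 1)%E)
    (hphi : left_derivative_at (phi q p) 1 1)
    (x : R) (hx : 0 < x) :
  (right_continuous_walk X q p ->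
    ((n%:R^-1)%:E * lne (P [set w | (x * n%:R <= record_number X n w)%R]))%E
      @[n --> \oo] --> (- (x%:E * legendre (Lambda_r q p) (1 / x)%R))%E) /\
  (left_continuous_walk X q p ->
    ((n%:R^-1)%:E * lne (P [set w | (x * n%:R <= record_number X n w)%R]))%E
      @[n --> \oo] --> (- (x%:E * legendre (Lambda_l q p) (1 / x)%R))%E).
Proof.
have [X_indep _] := hX.
have w0 := weight_ge0 hq hp; have w1 := weight_series hq hp hqp.
have law (step : nat -> int) : injective step ->
    (forall i j, P (X i @^-1` [set step j]) = (step_weight q p j)%:E) ->
    (fun n => (n%:R^-1)%:E * lne (P [set w | (x * n%:R <= record_number X n w)%R]))%E =
    (fun n => (n%:R^-1)%:E * lne (record_law (step_weight q p) step n 0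
      `|Num.ceil (x * n%:R)|%N))%E.
  by move=> stepI XP; apply/funext => n; rewrite (record_number_law n w0 w1 stepI XP).
split=> XP.
- rewrite (law right_step).
  + by apply: right_record_rate => // n; exact: ceil_nat_itv.
  + by move=> i j; rewrite /right_step; lia.
  + move=> i [|j]; have [Xq Xp] := XP i; first by rewrite /right_step subr0.
    by rewrite -[RHS]/((p j)%:E) -Xp /right_step -addn1 PoszD opprD addrA addrAC subrr add0r.
- rewrite (law left_step).
  + by apply: left_record_rate => // n; exact: ceil_nat_itv.
  + by move=> i j; rewrite /left_step; lia.
  + move=> i [|j]; have [Xq Xp] := XP i; first by rewrite /left_step sub0r.
    by rewrite -[RHS]/((p j)%:E) -Xp /left_step -addn1 PoszD addrK.
Qed.
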